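(* Let $X_1,X_2,\dots$ be i.i.d. with ${\sf E}X_1=0$ and $0<\sigma^2={\sf E}X_1^2<\infty$. Let $\Lambda_n$ be a positive random variable with ${\sf E}\Lambda_n<\infty$ and let $N_n^\star$ be a nonnegative integer-valued random variable, independent of $X_1,X_2,\dots$, with the mixed Poisson distribution $${\sf P}(N_n^\star=k)=\int_0^\infty e^{-\lambda}\frac{\lambda^k}{k!}\,d{\sf P}(\Lambda_n<\lambda),\quad k=0,1,2,\dots$$ Then $$\Delta_n^\star\equiv\sup_x\Big|{\sf P}\big(S_{N_n^\star}<x\sigma\sqrt{{\sf E}\Lambda_n}\big)-\int_0^\infty\Phi\Big(\frac{x}{\sqrt\lambda}\Big)d{\sf P}(\Lambda_n<\lambda{\sf E}\Lambda_n)\Big|\le\frac{1.8546}{\sigma^2}{\sf E}X_1^2\min\Big\{1,\frac{|X_1|}{\sigma\sqrt{\Lambda_n}}\Big\}$$ $$=\frac{1.8546}{\sigma^2}\Big[{\sf E}X_1^2\mathbb I\big(|X_1|\ge\sigma\sqrt{\Lambda_n}\big)+{\sf E}\frac{|X_1|^3}{\sigma\sqrt{\Lambda_n}}\mathbb I\big(|X_1|<\sigma\sqrt{\Lambda_n}\big)\Big],$$ where in the expectations on the right-hand side $X_1$ and $\Lambda_n$ are taken independent.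
   Context: $S_N=X_1+\dots+X_N$, $S_N=0$ if $N=0$. $\Phi$ is the standard normal distribution function; $\mathbb I(A)$ is the indicator of $A$. *)

(* Defs.v *)
From HB Require Import structures.
From mathcomp Require Import all_boot all_order all_algebra.
From mathcomp Require Import all_classical all_reals all_analysis.
Set Implicit Arguments. Unset Strict Implicit. Unset Printing Implicit Defensive.
Import Order.TTheory GRing.Theory Num.Theory.
Local Open Scope classical_set_scope.
Local Open Scope ring_scope.

Definition Phi {R : realType} (x : R) : R :=
  fine (normal_prob (0:R) 1 `]-oo, x]).

(* Partial sums S_n = X_1 + ... + X_n (X_1 is X 0), S_0 = 0. *)
Definition Ssum {T} {R : realType} (X : nat -> T -> R) (n : nat) (w : T) : R :=
  \sum_(i < n) X i w.

(* Mutual independence of a sequence of real random variables: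
   product rule for the first n variables and arbitrary Borel sets
   (taking B i = setT gives every finite subfamily). *)
Definition mutually_independent {d} {T : measurableType d} {R : realType}
  (P : probability T R) (X : nat -> {RV P >-> R}) : Prop :=
  forall (n : nat) (B : nat -> set R), (forall i, measurable (B i)) ->
    P (\bigcap_(i in `I_n) (X i) @^-1` (B i)) =
    (\prod_(i < n) P ((X i) @^-1` (B i)))%E.

Definition identically_distributed {d} {T : measurableType d} {R : realType}
  (P : probability T R) (X : nat -> {RV P >-> R}) : Prop :=
  forall (i : nat) (B : set R), measurable B ->
    P ((X i) @^-1` B) = P ((X 0%N) @^-1` B).

(* The nat-valued random variable N is independent of the whole sequence X:
   independence of sigma(N) from the pi-system of finite cylinder events,
   which generates sigma(X_1, X_2, ...). *)
Definition independent_of_seq {d} {T : measurableType d} {R : realType}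
  (P : probability T R) (N : T -> nat) (X : nat -> {RV P >-> R}) : Prop :=
  forall (k n : nat) (B : nat -> set R), (forall i, measurable (B i)) ->
    P (N @^-1` [set k] `&` \bigcap_(i in `I_n) (X i) @^-1` (B i)) =
    (P (N @^-1` [set k]) * P (\bigcap_(i in `I_n) (X i) @^-1` (B i)))%E.

(* Main.v *)
Require Import Defs.
From HB Require Import structures.
From mathcomp Require Import all_boot all_order all_algebra.
From mathcomp Require Import all_classical all_reals all_analysis.
From mathcomp Require Import measurable_realfun.
From mathcomp Require Import ring lra.
Set Implicit Arguments.
Unset Strict Implicit.
Import Order.TTheory GRing.Theory Num.Theory.
Import numFieldNormedType.Exports.
Local Open Scope classical_set_scope.
Local Open Scope ring_scope.

(* Conditionally on the mixing variable the sum is compound Poisson, so it is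
   enough to bound the compound Poisson law Q with parameter l and jump law mu
   for each fixed l and to integrate over l.  If W is a normalized compound
   Poisson variable and Y an independent normalized jump (l E Y^2 = 1), then
   E W f(W) = l E Y f(W + Y).  With f the solution of the Stein equation
   f'(w) - w f(w) = 1(w <= z) - Phi(z) this turns P(W <= z) - Phi(z) into
   l E [Y^2 f'(W) - Y (f(W + Y) - f(W))].  The bracket is at most Y^2, which is
   used for |Y| > 1.  For 0 <= Y <= 1 only the jump of f' at z contributes
   positively, because w f(w) is nondecreasing; it is controlled by a
   concentration inequality for W, obtained from the same identity with a
   clamped linear f.  For -1 <= Y <= 0 only the smooth part of f' contributes,
   and it gives a third moment.  Since these two contributions are not added, the
   constant stays below 1.85.  The lower bound follows by reflection. *)

(** * Gaussian tails *)

Section Monotonicity.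
Context {R : realType}.

(** Each conditional law is normalized by its own intensity [l], not by the mean intensity. With
    [Y = X / (sigma sqrt l)] one has [l E Y^2 min(1, |Y|) = E X^2 min(1, |X| / (sigma sqrt l)) /
    sigma^2], so integrating over [l] reproduces the right-hand side without loss. The Stein
    identity is available for bounded [f] only. Hence linear test functions are clamped, and the
    size of [W] is controlled through [E |W| <= 1], itself obtained from a clamped function. Split
    the moment into [b2] (from [|Y| > 1]) and [b3] (from [|Y| <= 1]). A bound above 1 is trivial, so
    [b2 + b3 <= 20/37] may be assumed; this keeps the denominator [7/12 - b2] of the concentration
    inequality positive. Constants: [17/16] bounds [f]; [25/32 = (17/16 + 1/2) / 2] serves negative
    jumps; [3/8] comes from two windows of lengths [Y] and [Y/2] for positive jumps; [3/5 b3] is the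
    margin by which the concentration window is enlarged on each side. The final inequality in [b2]
    and [b3] then holds with [37/20]. *)

Lemma derive_ge0_le (f df : R -> R) (a b : R) :
  a <= b -> (forall x, x \in `]a, b[ -> is_derive x 1 f (df x)) ->
  {within `[a, b], continuous f} ->
  (forall x, x \in `]a, b[ -> 0 <= df x) -> f a <= f b.
Proof.
rewrite le_eqVlt => /predU1P[->//|ab] fd fc df0.
have [c cab] := MVT ab fd fc.
by rewrite -subr_ge0 => ->; rewrite mulr_ge0 ?df0// subr_ge0 ltW.
Qed.

End Monotonicity.

Section Gauss.
Context {R : realType}.
Implicit Types x y w z : R.

Definition gauss_cst : R := Num.sqrt (2 * pi).
Local Notation c := gauss_cst.

Lemma gauss_cst_gt0 : 0 < c.
Proof. by rewrite sqrtr_gt0 mulr_gt0 ?pi_gt0. Qed.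

(** Only [2 <= pi < 4] is used, which gives [c < sqrt 8 < 2.84]. The later estimate
    [c / 4 + 1 / c <= 17 / 16] would fail beyond about 2.843. *)
Lemma gauss_cst_bounds : 2 <= c <= 284 / 100.
Proof.
have c2 : c ^+ 2 = 2 * pi by rewrite sqr_sqrtr// mulr_ge0 ?pi_ge0.
have c0 := gauss_cst_gt0.
have p2 := @pi_ge2 R; have p4 := @pihalf_lt2 R.
by apply/andP; split; nra.
Qed.

Lemma derive_Phi x : is_derive x 1 (@Phi R) (expR (- (x ^+ 2 / 2)) / c).
Proof.
have [] := @continuous_FTC1 R (normal_pdf 0 1) -oo%O x (x + 1).
- by rewrite ltrDl.
- by apply: integrableS (integrable_normal_pdf 0 1).
- by rewrite ltNyr.
- exact: continuous_normal_pdf.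
move=> dF eF.
split; first exact: dF.
rewrite -derive1E; transitivity (normal_pdf 0 1 x); first exact: eF.
rewrite normal_pdfE ?oner_neq0// mulrC /normal_fun /normal_peak subr0.
by rewrite !expr1n mul1r -mulr_natl mulr1 mulNr /c -(mulr_natl pi).
Qed.

Lemma Phi_ge0 x : 0 <= @Phi R x.
Proof. exact: fine_ge0. Qed.

Lemma Phi_EFin x : (@Phi R x)%:E = normal_prob 0 1 `]-oo, x].
Proof. by rewrite fineK// fin_num_measure. Qed.

(** The identity as a random variable under the normal law, so that [Phi] is its distribution
    function and has limit 0 at minus infinity. *)
Let idR : measurableTypeR R -> R := idfun.

#[local] HB.instance Definition _ :=
  @isMeasurableFun.Build _ _ _ _ idR (@measurable_id _ _ setT).

Lemma cvg_PhiNy : @Phi R x @[x --> -oo] --> (0 : R).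
Proof.
by have /fine_cvgP[] := cvg_cdfNy0 (idR : {RV (normal_prob (0 : R) 1) >-> R}).
Qed.

Lemma Phi_small (e : R) : 0 < e -> exists M, forall x, x <= M -> @Phi R x < e.
Proof.
move=> e0; have /cvgrPdist_lt /(_ e e0) := cvg_PhiNy.
move=> [M [_ MP]]; exists (M - 1) => x xM.
have := MP x ltac:(lra).
by rewrite /= sub0r normrN ger0_norm// Phi_ge0.
Qed.

Lemma PhiN x : @Phi R (- x) = 1 - Phi x.
Proof.
apply/eqP; rewrite -eqe EFinB !Phi_EFin.
have -> : normal_prob (0 : R) 1 `]-oo, - x] = normal_prob (0 : R) 1 `[x, +oo[.
  rewrite /normal_prob ge0_integration_by_substitutionNy.
  - apply: eq_integral => y _ /=; congr EFin.
    by rewrite !normal_pdfE ?oner_neq0// /normal_fun !subr0 sqrrN.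
  - exact/continuous_subspaceT/continuous_normal_pdf/oner_neq0.
  - by move=> y _; exact: normal_pdf_ge0.
have -> : normal_prob (0 : R) 1 `]-oo, x] = normal_prob (0 : R) 1 `]-oo, x[.
  rewrite /normal_prob -integral_itv_bndo_bndc//.
  apply/measurable_EFinP/measurable_funTS; exact: measurable_normal_pdf.
apply/eqP; rewrite -[RHS](@probability_setC _ _ _ (normal_prob (0 : R) 1) `]-oo, x[)//.
by congr (normal_prob 0 1 _); rewrite setCitvl.
Qed.
Lemma Phi_le1 x : @Phi R x <= 1.
Proof. by have := Phi_ge0 (- x); rewrite PhiN subr_ge0. Qed.

End Gauss.

Section DeriveRules.
Context {R : realType}.
Implicit Types (f g : R -> R) (x : R).

Lemma is_deriveM_fun f g x df dg : is_derive x 1 f df -> is_derive x 1 g dg ->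
  is_derive x 1 (fun t => f t * g t) (df * g x + f x * dg).
Proof.
move=> hf hg; apply: is_derive_eq (is_deriveM hf hg) _.
by rewrite /GRing.scale/= addrC mulrC.
Qed.

Lemma is_deriveD_fun f g x df dg : is_derive x 1 f df -> is_derive x 1 g dg ->
  is_derive x 1 (fun t => f t + g t) (df + dg).
Proof. by move=> hf hg; exact: (is_deriveD hf hg). Qed.

Lemma is_deriveN_fun f x df : is_derive x 1 f df ->
  is_derive x 1 (fun t => - f t) (- df).
Proof. by move=> hf; exact: (is_deriveN hf). Qed.

Lemma is_deriveMl_fun (k : R) g x dg : is_derive x 1 g dg ->
  is_derive x 1 (fun t => k * g t) (k * dg).
Proof.
move=> hg; apply: is_derive_eq (is_deriveM_fun (is_derive_cst k x 1) hg) _.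
by rewrite mul0r add0r.
Qed.

Lemma is_derive_expR_comp f x df : is_derive x 1 f df ->
  is_derive x 1 (fun t => expR (f t)) (expR (f x) * df).
Proof. by move=> hf; exact: (is_derive1_comp (is_derive_expR (f x)) hf). Qed.

Lemma is_derive_half_sqr x : is_derive x 1 (fun t : R => t ^+ 2 / 2) x.
Proof.
have h := is_deriveM_fun (is_deriveM_fun (is_derive_id x 1) (is_derive_id x 1))
  (is_derive_cst (2^-1 : R) x 1).
have -> : (fun t : R => t ^+ 2 / 2) = (fun t => id t * id t * cst 2^-1 t).
  by apply/funext => t; rewrite expr2.
by apply: is_derive_eq h _; rewrite /cst/=; field.
Qed.

Lemma is_derive_comp_opp f x df : is_derive (- x) 1 f df ->
  is_derive x 1 (fun t => f (- t)) (- df).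
Proof.
move=> hf; apply: (@is_derive_eq _ _ _ _ _ _ _ _
  (is_derive1_comp hf (is_deriveNid x 1))).
by rewrite mulrN1.
Qed.

End DeriveRules.

(** * Mills ratio of the normal law *)

Section Mills.
Context {R : realType}.
Implicit Types x y w z : R.
Local Notation c := (@gauss_cst R).

(** The Mills ratio: the Gaussian tail [1 - Phi x] divided by the density at [x]. *)
Definition mills x := c * expR (x ^+ 2 / 2) * Phi (- x).
Local Notation r := mills.

Lemma mills_ge0 x : 0 <= r x.
Proof. by rewrite !mulr_ge0 ?expR_ge0 ?Phi_ge0// ltW// gauss_cst_gt0. Qed.

Lemma derive_mills x : is_derive x 1 r (x * r x - 1).
Proof.
apply: (@is_derive_eq _ _ _ _ _ _ _ _ (is_deriveM_fun (is_deriveM_fun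
  (is_derive_cst c x 1) (is_derive_expR_comp (is_derive_half_sqr x)))
  (is_derive_comp_opp (derive_Phi (- x))))).
rewrite /r /cst ?sqrrN expRN; have := expR_gt0 (x ^+ 2 / 2); have := @gauss_cst_gt0 R.
move: (expR _) (Phi _) => e p c0 e0.
by field; rewrite !gt_eqF.
Qed.

Lemma Phi_mills x : Phi (- x) = r x * (expR (- (x ^+ 2 / 2)) / c).
Proof.
rewrite /r expRN; have := expR_gt0 (x ^+ 2 / 2); have := @gauss_cst_gt0 R.
move: (expR _) (Phi _) => e p c0 e0.
by field; rewrite !gt_eqF.
Qed.

Lemma mills_reflect x : r (- x) * Phi (- x) = r x * Phi x.
Proof. by rewrite /r sqrrN opprK; ring. Qed.

Lemma derive_ge0_leT (f df : R -> R) (a b : R) :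
  a <= b -> (forall x, is_derive x 1 f (df x)) ->
  (forall x, x \in `]a, b[ -> 0 <= df x) -> f a <= f b.
Proof.
move=> ab fd; apply: derive_ge0_le => //.
by apply: derivable_within_continuous => x _; apply: ex_derive.
Qed.

Lemma derive_le0_geT (f df : R -> R) (a b : R) :
  a <= b -> (forall x, is_derive x 1 f (df x)) ->
  (forall x, x \in `]a, b[ -> df x <= 0) -> f b <= f a.
Proof.
move=> ab fd df0; rewrite -lerN2.
apply: (@derive_ge0_leT (fun x => - f x) (fun x => - df x)) => //.
by move=> x /df0; rewrite oppr_ge0.
Qed.

Let phi x : R := expR (- (x ^+ 2 / 2)) / c.

Let phi_gt0 x : 0 < phi x.
Proof. by rewrite divr_gt0 ?expR_gt0 ?gauss_cst_gt0. Qed.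

Let derive_phi x : is_derive x 1 phi (- (x * phi x)).
Proof.
apply: (@is_derive_eq _ _ _ _ _ _ _ _ (is_deriveM_fun (is_derive_expR_comp
  (is_deriveN_fun (is_derive_half_sqr x))) (is_derive_cst c^-1 x 1))).
by rewrite /phi /cst mulr0 addr0 mulrN mulNr mulrC mulrA; congr (- _); rewrite mulrC [_ * x]mulrC; ring.
Qed.

Let derive_PhiN x : is_derive x 1 (fun t => Phi (- t)) (- phi x).
Proof.
apply: (@is_derive_eq _ _ _ _ _ _ _ _ (is_derive_comp_opp (derive_Phi (- x)))).
by rewrite sqrrN.
Qed.

(* [phi t - x * Phi (- t)] with [x] frozen is nonincreasing for [t >= x] and its
   lower limit at infinity is nonnegative. *)
Lemma mul_mills_le1 x : x * r x <= 1.
Proof.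
have [x0|x0] := leP x 0; first by rewrite (le_trans (mulr_le0_ge0 x0 (mills_ge0 x))).
suff h : x * Phi (- x) <= phi x.
  have p0 := phi_gt0 x; rewrite -(ler_pM2r p0) mul1r -mulrA.
  by rewrite -/(phi x) -Phi_mills.
rewrite leNgt; apply/negP => lt.
set e := (x * Phi (- x) - phi x) / x.
have e0 : 0 < e by rewrite divr_gt0// subr_gt0.
have [M PhiM] := Phi_small e0.
pose t := Order.max x (- M).
have xt : x <= t by rewrite le_max lexx.
have tM : - t <= M by rewrite lerNl le_max lexx orbT.
have : phi t - x * Phi (- t) <= phi x - x * Phi (- x).
  apply: (@derive_le0_geT (fun t => phi t - x * Phi (- t))
    (fun t => - (t * phi t) - (x * - phi t)) x t xt) => y.
    exact: (is_deriveD_fun (derive_phi y)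
      (is_deriveN_fun (is_deriveMl_fun x (derive_PhiN y)))).
  rewrite in_itv/= => /andP[xy _].
  rewrite mulrN opprK addrC -mulrBl.
  by rewrite mulr_le0_ge0 ?(ltW (phi_gt0 y))// subr_le0 ltW.
have := PhiM _ tM; rewrite /e ltr_pdivlMr// mulrC => h1 h2.
by have := phi_gt0 t; lra.
Qed.

(* [(1 + x ^+ 2) * Phi (- t) - (2 * x - t) * phi t] has derivative
   [- (t - x) ^+ 2 * phi t] in [t]; compare [t = x] with [t = 2 * x]. *)
Lemma le_mul_mills x : x <= (1 + x ^+ 2) * r x.
Proof.
have [x0|x0] := leP x 0.
  by rewrite (le_trans x0)// mulr_ge0 ?mills_ge0// addr_ge0// sqr_ge0.
suff h : x * phi x <= (1 + x ^+ 2) * Phi (- x).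
  have p0 := phi_gt0 x; rewrite -(ler_pM2r p0) -mulrA.
  by rewrite -Phi_mills.
have : (1 + x ^+ 2) * Phi (- (2 * x)) - (2 * x - 2 * x) * phi (2 * x) <=
       (1 + x ^+ 2) * Phi (- x) - (2 * x - x) * phi x.
  apply: (@derive_le0_geT (fun t => (1 + x ^+ 2) * Phi (- t) - (2 * x - t) * phi t)
    (fun t => ((1 + x ^+ 2) * - phi t) -
              ((0 - 1) * phi t + (2 * x - t) * - (t * phi t))) x (2 * x)) => [|y|y _].
  - by lra.
  - exact: (is_deriveD_fun (is_deriveMl_fun _ (derive_PhiN y)) (is_deriveN_fun
      (is_deriveM_fun (is_deriveD_fun (is_derive_cst (2 * x) y 1)
         (is_deriveN_fun (is_derive_id y 1))) (derive_phi y)))).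
  - have := phi_gt0 y; move: (phi y) => p p0.
    rewrite (_ : _ - _ = - ((y - x) ^+ 2 * p)); last by ring.
    by rewrite oppr_le0 mulr_ge0 ?sqr_ge0// ltW.
have : 0 <= (1 + x ^+ 2) * Phi (- (2 * x)).
  by rewrite mulr_ge0 ?Phi_ge0// addr_ge0// sqr_ge0.
by lra.
Qed.

Lemma mills_le x : 0 <= x -> r x <= c / 2.
Proof.
move=> x0; have -> : c / 2 = r 0.
  rewrite /r oppr0 expr0n/= mul0r expR0 mulr1.
  by have := @PhiN R 0; rewrite oppr0 => h; congr (_ * _); lra.
apply: derive_le0_geT x0 derive_mills _ => y _.
by rewrite subr_le0 mul_mills_le1.
Qed.

Lemma Phi_le_linear x : 0 <= x -> Phi x <= 1 / 2 + x / c.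
Proof.
move=> x0; rewrite -subr_le0.
have -> : 0 = Phi 0 - (1 / 2 + 0 / c) :> R.
  by have := @PhiN R 0; rewrite oppr0 mul0r; lra.
apply: (@derive_le0_geT (fun t => Phi t - (1 / 2 + t / c))
  (fun t => phi t - (0 + c^-1 * 1)) 0 x x0) => [y|y _].
  rewrite (_ : (fun t => _) = (fun t => Phi t - (1 / 2 + c^-1 * t))).
    exact: (is_deriveD_fun (derive_Phi y) (is_deriveN_fun (is_deriveD_fun
      (is_derive_cst (1 / 2 : R) y 1) (is_deriveMl_fun _ (is_derive_id y 1))))).
  by apply/funext => t; rewrite [t / c]mulrC.
rewrite add0r mulrC -mulrBl mulr_le0_ge0 ?invr_ge0 ?(ltW gauss_cst_gt0)//.
by rewrite subr_le0 -expR0 ler_expR oppr_le0 divr_ge0// sqr_ge0.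
Qed.

(** By [mills_reflect] one may take [0 <= x]. There [r x <= c / 2], [x * r x <= 1] and the tangent
    bound on [Phi] give [c / 4 + 1 / c], which is at most [17 / 16] for [c] between 2 and 2.84. *)
Lemma mills_mul_Phi_le x : r x * Phi x <= 17 / 16.
Proof.
wlog x0 : x / 0 <= x => [hw|].
  have [/hw//|/ltW] := leP 0 x; rewrite -oppr_ge0 => /hw.
  by rewrite mills_reflect.
have r0 := mills_ge0 x.
have rc := mills_le x0; have xr := mul_mills_le1 x; have Pl := Phi_le_linear x0.
have c0 := @gauss_cst_gt0 R; have /andP[c2 c3] := @gauss_cst_bounds R.
apply: (@le_trans _ _ (r x * (1 / 2 + x / c))); first exact: ler_wpM2l.
have -> : r x * (1 / 2 + x / c) = r x / 2 + x * r x / c by ring.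
apply: (@le_trans _ _ (c / 2 / 2 + 1 / c)).
  by rewrite lerD// ler_pM2r// invr_gt0.
rewrite -subr_ge0 (_ : _ - _ = (17 / 16 * c - c ^+ 2 / 4 - 1) / c); last first.
  by field; rewrite gt_eqF.
by rewrite divr_ge0 ?(ltW c0)//; nra.
Qed.

End Mills.

(** * The solution of the Stein equation *)

Section Stein.
Context {R : realType}.
Implicit Types a b s w x y z : R.

Lemma Phi_le_mono x y : x <= y -> @Phi R x <= Phi y.
Proof.
move=> xy; apply: derive_ge0_leT xy (@derive_Phi R) _ => t _.
by rewrite divr_ge0 ?expR_ge0// ltW// gauss_cst_gt0.
Qed.

Let stein_l z w := mills (- w) * Phi (- z).
Let stein_r z w := mills w * Phi z.

(** With [phi] the density, the branches are [Phi w (1 - Phi z) / phi w] and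
    [(1 - Phi w) Phi z / phi w], the bounded solution of the Stein equation. Written with Mills
    ratios, its properties reduce to bounds on [mills]. *)
Definition stein z w := if w <= z then mills (- w) * Phi (- z) else mills w * Phi z.

(* The derivative of [stein z], extended to [w = z] by its left limit. *)
Definition dstein z w := w * stein z w + (w <= z)%R%:R - Phi z.

Let stein_lE z w : w <= z -> stein z w = stein_l z w.
Proof. by rewrite /stein => ->. Qed.

Let stein_rE z w : z <= w -> stein z w = stein_r z w.
Proof.
rewrite /stein le_eqVlt => /predU1P[<-|zw]; last by rewrite leNgt zw.
by rewrite lexx mills_reflect.
Qed.

Lemma stein_ge0 z w : 0 <= stein z w.
Proof. by rewrite /stein; case: ifP => _; rewrite mulr_ge0 ?mills_ge0 ?Phi_ge0. Qed.

Lemma stein_le z w : stein z w <= 17 / 16.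
Proof.
have [wz|/ltW zw] := leP w z.
  rewrite stein_lE//; apply: le_trans (mills_mul_Phi_le (- w)).
  by rewrite ler_wpM2l ?mills_ge0// Phi_le_mono// lerN2.
rewrite stein_rE//; apply: le_trans (mills_mul_Phi_le w).
by rewrite ler_wpM2l ?mills_ge0// Phi_le_mono.
Qed.

Let derive_stein_l z w : is_derive w 1 (stein_l z) (w * stein_l z w + 1 - Phi z).
Proof.
have h := is_deriveMl_fun (Phi (- z)) (is_derive_comp_opp (derive_mills (- w))).
rewrite (_ : stein_l z = fun t => Phi (- z) * mills (- t)); last first.
  by apply/funext => t; rewrite mulrC.
by apply: is_derive_eq h _; rewrite PhiN; ring.
Qed.

Let derive_stein_r z w : is_derive w 1 (stein_r z) (w * stein_r z w - Phi z).
Proof.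
have h := is_deriveMl_fun (Phi z) (derive_mills w).
rewrite (_ : stein_r z = fun t => Phi z * mills t); last first.
  by apply/funext => t; rewrite mulrC.
by apply: is_derive_eq h _; rewrite /stein_r; ring.
Qed.

(** The derivative is [((1 + x ^+ 2) * mills (- x) + x) * (1 - Phi z)], nonnegative by the lower
    Mills bound [le_mul_mills] at [- x]. *)
Let stein_l_mono z a b : a <= b -> a * stein_l z a <= b * stein_l z b.
Proof.
move=> ab; apply: (@derive_ge0_leT _ (fun t => t * stein_l z t)
  (fun t => 1 * stein_l z t + t * (t * stein_l z t + 1 - Phi z))) ab _ _ => [x|x _].
  exact: (is_deriveM_fun (is_derive_id x 1) (derive_stein_l z x)).
have := le_mul_mills (- x); have := Phi_ge0 (- z).
rewrite /stein_l sqrrN PhiN => P0 h.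
rewrite (_ : _ + _ = ((1 + x ^+ 2) * mills (- x) + x) * (1 - Phi z)); last by ring.
by rewrite mulr_ge0//; lra.
Qed.

Let stein_r_mono z a b : a <= b -> a * stein_r z a <= b * stein_r z b.
Proof.
move=> ab; apply: (@derive_ge0_leT _ (fun t => t * stein_r z t)
  (fun t => 1 * stein_r z t + t * (t * stein_r z t - Phi z))) ab _ _ => [x|x _].
  exact: (is_deriveM_fun (is_derive_id x 1) (derive_stein_r z x)).
have := le_mul_mills x; have := Phi_ge0 z.
rewrite /stein_r => P0 h.
rewrite (_ : _ + _ = ((1 + x ^+ 2) * mills x - x) * Phi z); last by ring.
by rewrite mulr_ge0//; lra.
Qed.

Lemma mul_stein_mono z a b : a <= b -> a * stein z a <= b * stein z b.
Proof.
move=> ab; have [bz|/ltW zb] := leP b z.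
  by rewrite !stein_lE// ?stein_l_mono// (le_trans ab).
have [az|/ltW za] := leP a z; last by rewrite !stein_rE// stein_r_mono.
rewrite (stein_lE az) (stein_rE zb).
apply: (le_trans (stein_l_mono z az)); apply: le_trans (stein_r_mono z zb).
by rewrite -(stein_lE (lexx z)) -(stein_rE (lexx z)).
Qed.

(** Monotonicity of [w * stein z w] reduces the claim to [w <= z], where it is the upper Mills bound
    at [- w]. *)
Lemma mul_stein_ge z w : - Phi (- z) <= w * stein z w.
Proof.
wlog wz : w / w <= z => [hw|].
  have [/hw//|/ltW zw] := leP w z.
  exact: le_trans (hw z (lexx z)) (mul_stein_mono z zw).
rewrite stein_lE// /stein_l mulrA -mulN1r ler_wpM2r ?Phi_ge0//.
by have := mul_mills_le1 (- w); lra.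
Qed.

Lemma mul_stein_le z w : w * stein z w <= Phi z.
Proof.
wlog zw : w / z <= w => [hw|].
  have [/hw//|/ltW wz] := leP z w.
  exact: le_trans (mul_stein_mono z wz) (hw z (lexx z)).
rewrite stein_rE// /stein_r mulrA -[leRHS]mul1r ler_wpM2r ?Phi_ge0//.
exact: mul_mills_le1.
Qed.

(* The Stein solution is glued from two smooth pieces at [z], so the mean value
   theorem is applied on each side of [z]. *)
Lemma stein_increment_ge z (p dp : R -> R) a b :
  a <= b -> (forall x, is_derive x 1 p (dp x)) ->
  (forall x, x \in `]a, b[ -> x != z -> dp x <= dstein z x) ->
  p b - p a <= stein z b - stein z a.
Proof.
move=> ab pd dple.
have hl u v : u <= v -> a <= u -> v <= b -> v <= z ->
    p v - p u <= stein z v - stein z u.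
  move=> uv au vb vz; rewrite !stein_lE ?(le_trans uv)//.
  suff : stein_l z u - p u <= stein_l z v - p v by lra.
  apply: (@derive_ge0_leT _ (fun t => stein_l z t - p t) (fun t =>
    (t * stein_l z t + 1 - Phi z) - dp t) u v uv) => x.
    exact: (is_deriveD_fun (derive_stein_l z x) (is_deriveN_fun (pd x))).
  rewrite in_itv/= => /andP[ux xv].
  have xz : x < z by rewrite (lt_le_trans xv).
  have := dple x; rewrite in_itv/= (le_lt_trans au)// (lt_le_trans xv)//.
  move=> /(_ isT (negbT (lt_eqF xz))).
  by rewrite /dstein (ltW xz) stein_lE ?(ltW xz)// subr_ge0.
have hr u v : u <= v -> a <= u -> v <= b -> z <= u ->
    p v - p u <= stein z v - stein z u.
  move=> uv au vb zu; rewrite !stein_rE ?(le_trans zu)//.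
  suff : stein_r z u - p u <= stein_r z v - p v by lra.
  apply: (@derive_ge0_leT _ (fun t => stein_r z t - p t) (fun t =>
    (t * stein_r z t - Phi z) - dp t) u v uv) => x.
    exact: (is_deriveD_fun (derive_stein_r z x) (is_deriveN_fun (pd x))).
  rewrite in_itv/= => /andP[ux xv].
  have xz : z < x by rewrite (le_lt_trans zu).
  have := dple x; rewrite in_itv/= (le_lt_trans au)// (lt_le_trans xv)//.
  move=> /(_ isT (negbT (gt_eqF xz))).
  by rewrite /dstein (lt_geF xz)/= addr0 stein_rE ?(ltW xz)// subr_ge0.
have [bz|/ltW zb] := leP b z; first exact: hl.
have [az|/ltW za] := leP a z; last exact: hr.
by have := hl _ _ az (lexx _) zb (lexx z); have := hr _ _ zb az (lexx _) (lexx z); lra.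
Qed.

Lemma dstein_bounds z w : -1 <= dstein z w <= 1.
Proof.
have := mul_stein_ge z w; have := mul_stein_le z w; rewrite /dstein PhiN.
have := @Phi_ge0 R z; have := @Phi_le1 R z.
by case: (leP w z) => _; rewrite ?mulr1n ?mulr0n => *; apply/andP; split; lra.
Qed.

(** On one side of [z] the difference is one of values of [x * stein z x], which range in an
    interval of length [Phi z + Phi (- z) = 1]. If [w <= z < v], the jump contributes 1 and
    monotonicity makes the rest nonpositive; if [v <= z < w], the jump has the favourable sign. *)
Lemma dstein_sub_le1 z v w : dstein z w - 1 <= dstein z v.
Proof.
have := mul_stein_ge z w; have := mul_stein_le z w.
have := mul_stein_ge z v; have := mul_stein_le z v.
have := @Phi_ge0 R z; have := @Phi_le1 R z; rewrite !PhiN.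
rewrite /dstein; have [vw|/ltW wv] := leP v w.
  case: (leP w z) => [wz|zw]; first by rewrite (le_trans vw)// mulr1n => *; lra.
  by case: (leP v z) => _; rewrite ?mulr1n ?mulr0n => *; lra.
have := mul_stein_mono z wv.
by case: (leP w z) => [wz|zw]; case: (leP v z) => [vz|zv]; rewrite ?mulr1n ?mulr0n => *; lra.
Qed.

Lemma stein_reflect z w : stein (- z) (- w) = stein z w.
Proof.
have [wz|/ltW zw] := leP w z.
  by rewrite stein_rE ?lerN2// stein_lE.
by rewrite stein_lE ?lerN2// stein_rE// /stein_l !opprK.
Qed.

Lemma stein_increment_ge_lin z k a b : a <= b ->
  (forall x, x \in `]a, b[ -> x != z -> k <= dstein z x) ->
  k * (b - a) <= stein z b - stein z a.
Proof.
move=> ab h; rewrite mulrBr; apply: (@stein_increment_ge z (fun x => k * x)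
  (fun=> k * 1) a b ab) => x.
by rewrite mulr1; exact: h.
Qed.

Lemma stein_lipschitz z a b : a <= b -> `|stein z b - stein z a| <= b - a.
Proof.
move=> ab.
have h z' a' b' : a' <= b' -> - (b' - a') <= stein z' b' - stein z' a'.
  move=> ab'; rewrite -mulN1r; apply: stein_increment_ge_lin => // x _ _.
  by have /andP[] := dstein_bounds z' x.
rewrite ler_norml h//=.
(* The upper bound is the lower bound for the reflected solution. *)
have := h (- z) (- b) (- a) ltac:(by rewrite lerN2).
by rewrite !stein_reflect; lra.
Qed.

Lemma stein_incr_left z a b : a <= b -> b <= z -> stein z a <= stein z b.
Proof.
move=> ab bz; rewrite -subr_ge0 -(mul0r (b - a)).
apply: stein_increment_ge_lin => // x; rewrite in_itv/= => /andP[_ xb] _.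
have := mul_stein_ge z x; rewrite PhiN /dstein (ltW (lt_le_trans xb bz)) mulr1n.
by lra.
Qed.

Lemma stein_decr_right z a b : a <= b -> z <= a -> stein z b <= stein z a.
Proof.
by move=> ab za; rewrite -!(stein_reflect z) stein_incr_left// lerN2.
Qed.

Definition stein_defect z w y :=
  y ^+ 2 * dstein z w - y * (stein z (w + y) - stein z w).

(* Only the part of [w] on the same side of 0 as [z] matters in the bound for
   negative jumps; this gains a factor 2, as [E W^+ = E W^- <= 1 / 2]. *)
Definition side_part z w := if 0 <= z then Num.max w 0 else Num.max (- w) 0.

Lemma side_part_ge0 z w : 0 <= side_part z w.
Proof. by rewrite /side_part; case: ifP => _; rewrite le_max lexx orbT. Qed.

(** The defect is [y] times the integral of [dstein z w - dstein z x] for [x] from [w] to [w + y],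
    and the integrand is at most 1 by [dstein_sub_le1]. *)
Lemma stein_defect_le_sqr z w y : stein_defect z w y <= y ^+ 2.
Proof.
have h a b : a <= b -> (dstein z w - 1) * (b - a) <= stein z b - stein z a.
  by move=> ab; apply: stein_increment_ge_lin => // x _ _; exact: dstein_sub_le1.
rewrite /stein_defect; move: (dstein z w) h => k h.
have [y0|/ltW y0] := leP 0 y.
  have := h w (w + y) ltac:(by rewrite lerDl).
  by move: (stein z (w + y) - stein z w) => u; nra.
have := h (w + y) w ltac:(by rewrite gerDl).
move: (stein z (w + y)) (stein z w) => u v; nra.
Qed.

(** If the jump does not cross [z], monotonicity of [x * stein z x] makes the defect nonpositive. If
    it crosses, only the stretch beyond [z] counts, giving the ramp [y * (w + y - z)]. The two
    indicators form a two-step staircase above this ramp, so that only window probabilities of [W]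
    are required. *)
Lemma stein_defect_le_pos z w y : 0 <= y ->
  stein_defect z w y <= y ^+ 2 / 2 *
    ((z - y <= w <= z)%R%:R + (z - y / 2 <= w <= z)%R%:R).
Proof.
move=> y0; have yw : w <= w + y by rewrite lerDl.
have ncross : (z < w) || (w + y <= z) -> stein_defect z w y <= 0.
  move=> zwy; rewrite /stein_defect.
  suff : dstein z w * y <= stein z (w + y) - stein z w.
    by move: (dstein z w) (stein z (w + y) - stein z w) => k u; nra.
  rewrite -[X in _ * X <= _](addrK w) [y + w]addrC; apply: stein_increment_ge_lin => // x.
  rewrite in_itv/= => /andP[wx xy] _.
  rewrite /dstein; have := mul_stein_mono z (ltW wx).
  suff -> : (w <= z) = (x <= z) by rewrite !lerD2r.
  case/orP: zwy => zwy; first by rewrite !leNgt zwy (lt_trans zwy wx).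
  by rewrite (le_trans (ltW xy) zwy) (le_trans (ltW wx))// (le_trans (ltW xy)).
have [zw|wz] := ltP z w.
  apply: (le_trans (ncross _)); first by rewrite zw.
  by rewrite !andbF addr0 mulr0.
have [wyz|zwy] := leP (w + y) z.
  apply: (le_trans (ncross _)); first by rewrite wyz orbT.
  by rewrite mulr_ge0// ?addr_ge0// divr_ge0// sqr_ge0.
(* Up to [z] the slope is at least [dstein z w]; beyond [z] ([h2]) it falls short of it by at most
   1. *)
have h1 : dstein z w * (z - w) <= stein z z - stein z w.
  apply: stein_increment_ge_lin => // x; rewrite in_itv/= => /andP[wx xz] _.
  by rewrite /dstein wz (ltW xz); have := mul_stein_mono z (ltW wx); lra.
have h2 : (dstein z w - 1) * (w + y - z) <= stein z (w + y) - stein z z.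
  by apply: stein_increment_ge_lin => [|x _ _]; [exact: ltW|exact: dstein_sub_le1].
have zyw : z - y <= w by lra.
rewrite zyw !andbT mulr1n.
have : stein_defect z w y <= y * (w + y - z).
  rewrite /stein_defect; move: (dstein z w) (stein z (w + y)) (stein z w) (stein z z) h1 h2 => k u v t h1 h2.
  have -> : u - v = (u - t) + (t - v) by lra.
  by nra.
move=> /le_trans; apply.
by case: (leP (z - y / 2) w) => hz; rewrite ?mulr1n ?mulr0n; nra.
Qed.

(** For [x] between [w + y] and [w], crossing [z] makes [dstein z w - dstein z x] nonpositive.
    Otherwise, with [f = stein z], it equals [w (f(w) - f(x)) + (w - x) f(x)]. The second term is at
    most [17 / 16 * (w - x)]. As [f] increases up to [z] and decreases after it, the first is
    nonpositive unless [w] lies between 0 and [z]; there the Lipschitz bound gives [|w| (w - x)],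
    and [|w|] is the side part. *)
Lemma stein_defect_le_neg z w y : y <= 0 ->
  stein_defect z w y <= `|y| ^+ 3 / 2 * (17 / 16 + side_part z w).
Proof.
move=> y0; have yw : w + y <= w by rewrite gerDl.
rewrite ler0_norm//; set K := 17 / 16 + _.
(* A quadratic comparison function: its slope at [x] is [dstein z w - K * (w - x)]. *)
pose p x := dstein z w * x + K * ((x - w) ^+ 2 / 2).
have dp x : is_derive x 1 p (dstein z w * 1 + K * ((x - w) * 1)).
  have hs : is_derive x 1 (fun t => t - w) 1.
    by apply: is_derive_eq (is_deriveD_fun (is_derive_id x 1) (is_derive_cst (- w) x 1)) _; rewrite addr0.
  have hc : is_derive x 1 (fun t => (t - w) ^+ 2 / 2) ((x - w) * 1).
    exact: (@is_derive1_comp _ (fun t : R => t ^+ 2 / 2) (fun t => t - w) x _ _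
      (is_derive_half_sqr (x - w)) hs).
  exact (is_deriveD_fun (is_deriveMl_fun (dstein z w) (is_derive_id x 1))
    (is_deriveMl_fun K hc)).
suff : p w - p (w + y) <= stein z w - stein z (w + y).
  have -> : p w - p (w + y) = - (dstein z w * y + K * (y ^+ 2 / 2)) by rewrite /p; ring.
  rewrite /stein_defect; move: (dstein z w) (stein z w) (stein z (w + y)) => k u v h.
  have : - y * - (k * y + K * (y ^+ 2 / 2)) <= - y * (u - v).
    by rewrite ler_wpM2l// oppr_ge0.
  by clearbody K; clear p dp h; lra.
apply: stein_increment_ge dp _ => // x; rewrite in_itv/= => /andP[yx xw] xz.
rewrite !mulr1.
have [wz|zw] := leP w z; last first.
  have [xz'|zx] := leP x z.
    have := mul_stein_ge z x; have := mul_stein_le z w.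
    rewrite /dstein PhiN xz' (lt_geF zw) mulr1n mulr0n.
    have : 0 <= K * (w - x).
      by rewrite mulr_ge0 ?subr_ge0 ?(ltW xw)// addr_ge0 ?side_part_ge0.
    by lra.
  rewrite /dstein (lt_geF zw) (lt_geF zx).
  have := stein_le z x; have := stein_decr_right (ltW xw) (ltW zx).
  have := stein_lipschitz z (ltW xw); rewrite ler_norml => /andP[l1 l2] d1 s1.
  move: l1 l2 d1 s1; rewrite /K /side_part.
  move: (stein z w) (stein z x) => u v l1 l2 d1 s1.
  rewrite mulr0n; have xw0 : 0 <= w - x by rewrite subr_ge0 ltW.
  have p1 : 0 <= (w - x) * (17 / 16 - v) by rewrite mulr_ge0// subr_ge0.
  have [w0|w0] : 0 <= w \/ w <= 0 by exact/orP/le_total.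
    have : 0 <= (if 0 <= z then Num.max w 0 else Num.max (- w) 0) by exact: side_part_ge0.
    move: (if _ then _ else _) => A A0.
    have p2 : 0 <= A * (w - x) by rewrite mulr_ge0.
    have p3 : 0 <= w * (v - u) by rewrite mulr_ge0// subr_ge0.
    by lra.
  rewrite (lt_geF (lt_le_trans zw w0)) max_l ?oppr_ge0//.
  have p2 : 0 <= - w * (u - v + (w - x)) by rewrite mulr_ge0//; lra.
  by lra.
have xz' : x <= z by rewrite (le_trans (ltW xw)).
rewrite /dstein wz xz' mulr1n.
have := stein_le z x; have := stein_incr_left (ltW xw) wz.
have := stein_lipschitz z (ltW xw); rewrite ler_norml => /andP[l1 l2] d1 s1.
move: l1 l2 d1 s1; rewrite /K /side_part.
move: (stein z w) (stein z x) => u v l1 l2 d1 s1.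
have xw0 : 0 <= w - x by rewrite subr_ge0 ltW.
have p1 : 0 <= (w - x) * (17 / 16 - v) by rewrite mulr_ge0// subr_ge0.
have [w0|w0] : 0 <= w \/ w <= 0 by exact/orP/le_total.
  rewrite (le_trans w0 wz) max_l//.
  have p2 : 0 <= w * (w - x - (u - v)) by rewrite mulr_ge0//; lra.
  by lra.
have : 0 <= (if 0 <= z then Num.max w 0 else Num.max (- w) 0) by exact: side_part_ge0.
move: (if _ then _ else _) => A A0.
have p2 : 0 <= A * (w - x) by rewrite mulr_ge0.
have p3 : 0 <= - w * (u - v) by rewrite mulr_ge0 ?oppr_ge0// subr_ge0.
by lra.
Qed.

End Stein.

(** * The Stein bound *)

Section Integrability.
Context d (T : measurableType d) (R : realType) (P : probability T R).
Implicit Types f g : T -> R.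

Lemma integrable_dominated f g : measurable_fun setT f ->
  P.-integrable setT (EFin \o g) -> (forall x, `|f x| <= g x) ->
  P.-integrable setT (EFin \o f).
Proof.
move=> mf ig fg; apply: le_integrable ig => //; first exact/measurable_EFinP.
by move=> x _ /=; rewrite lee_fin (le_trans (fg x))// ler_norm.
Qed.

Lemma integrable_bounded f (M : R) : measurable_fun setT f ->
  (forall x, `|f x| <= M) -> P.-integrable setT (EFin \o f).
Proof.
move=> mf; apply: integrable_dominated => //.
exact: finite_measure_integrable_cst.
Qed.

Lemma integrableD_fun f g : P.-integrable setT (EFin \o f) ->
  P.-integrable setT (EFin \o g) ->
  P.-integrable setT (EFin \o (fun x => f x + g x)).
Proof. by move=> fi gi; have := integrableD measurableT fi gi. Qed.

Lemma integrableB_fun f g : P.-integrable setT (EFin \o f) ->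
  P.-integrable setT (EFin \o g) ->
  P.-integrable setT (EFin \o (fun x => f x - g x)).
Proof. by move=> fi gi; have := integrableB measurableT fi gi. Qed.

Lemma integrableMl_fun k f : P.-integrable setT (EFin \o f) ->
  P.-integrable setT (EFin \o (fun x => k * f x)).
Proof. by move=> fi; have := integrableZl measurableT k fi. Qed.

Lemma integrable_cst_fun (k : R) : P.-integrable setT (EFin \o (fun=> k)).
Proof. exact: finite_measure_integrable_cst. Qed.

Lemma integral_cst_prob (k : \bar R) : (\int[P]_x k = k)%E.
Proof.
by rewrite integral_cst// -[RHS]mule1; congr (_ * _)%E; exact: probability_setT.
Qed.

Lemma Rintegral_cst_prob (k : R) : \int[P]_x k = k.
Proof. by rewrite /Rintegral integral_cst_prob. Qed.

Lemma integrable_sqr f : measurable_fun setT f ->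
  P.-integrable setT (EFin \o (fun x => f x ^+ 2)) ->
  P.-integrable setT (EFin \o f).
Proof.
move=> mf if2; apply: (@integrable_dominated _ (fun x => 1 + f x ^+ 2)) => //.
  exact: integrableD_fun (integrable_cst_fun 1) if2.
by move=> x; rewrite ler_norml; apply/andP; split; nra.
Qed.

End Integrability.

Section BoundedParameter.
Context d1 d2 (T1 : measurableType d1) (T2 : measurableType d2) (R : realType).

Lemma measurable_Rintegral_bounded (m : probability T1 R) (F : T1 * T2 -> R) (M : R) :
  measurable_fun setT F -> (forall p, `|F p| <= M) ->
  measurable_fun setT (fun y => \int[m]_x F (x, y)).
Proof.
move=> mF FM.
have mFy y : measurable_fun setT (fun x => F (x, y)).
  by apply: measurableT_comp => //; exact: measurable_pair2.
(* Adding [M] makes the integrand nonnegative, as Tonelli measurability requires. *)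
rewrite (_ : (fun y => _) = fun y => fine (\int[m]_x (F (x, y) + M)%:E)%E - M).
  apply: measurable_funB => //; apply: measurableT_comp => //.
  apply: (@measurable_fun_fubini_tonelli_G _ _ T1 T2 R m (fun p => (F p + M)%:E)).
    by apply/measurable_EFinP/measurable_funD.
  by move=> p; rewrite lee_fin; have := FM p; rewrite ler_norml => /andP[]; lra.
apply/funext => y; rewrite -/(Rintegral _ _ _) RintegralD//.
- by rewrite Rintegral_cst_prob addrK.
- exact: integrable_bounded (fun w => FM _).
- exact: integrable_cst_fun.
Qed.

Lemma normr_Rintegral_bounded (m : probability T1 R) (f : T1 -> R) (M : R) :
  measurable_fun setT f -> (forall x, `|f x| <= M) -> `|\int[m]_x f x| <= M.
Proof.
move=> mf fM; have iF := integrable_bounded m mf fM.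
apply: (le_trans (le_normr_Rintegral measurableT iF)).
rewrite -[leRHS](Rintegral_cst_prob m); apply: le_Rintegral => //.
- exact: integrable_norm.
- exact: integrable_cst_fun.
Qed.

End BoundedParameter.

Section SteinMeasurability.
Context {R : realType}.

Lemma measurable_of_derive (f df : R -> R) : (forall x : R, is_derive x 1 f (df x)) ->
  measurable_fun setT f.
Proof.
move=> fd; apply: continuous_measurable_fun => x.
by apply/differentiable_continuous/derivable1_diffP; apply: ex_derive.
Qed.

Lemma measurable_Phi : measurable_fun setT (@Phi R).
Proof. exact: measurable_of_derive (@derive_Phi R). Qed.

Lemma measurable_stein (z : R) : measurable_fun setT (stein z).
Proof.
have mm := measurable_of_derive (@derive_mills R).
apply: measurable_fun_ifT; first exact: measurable_fun_ler.
- apply: measurable_funM => //; apply: measurableT_comp => //.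
- by apply: measurable_funM.
Qed.

End SteinMeasurability.

Section IndicatorMeasurability.
Context d (T : measurableType d) {R : realType}.
Implicit Types f g : T -> R.

Lemma measurable_natr_bool (b : T -> bool) : measurable_fun setT b ->
  measurable_fun setT (fun x => (b x)%:R : R).
Proof.
move=> mb; have -> : (fun x => (b x)%:R) = (fun x => if b x then 1 else 0 : R).
  by apply/funext => x; case: (b x).
exact: measurable_fun_ifT.
Qed.

Lemma ler_normM_bool (x : R) (b : bool) : `|x * b%:R| <= `|x|.
Proof. by case: b; rewrite ?mulr1 ?mulr0 ?normr0. Qed.

End IndicatorMeasurability.

(** * Clamped linear test functions *)

Section Clamp.
Context {R : realType}.
Implicit Types l u a b w y x : R.

Definition clamp l u x := Num.max l (Num.min x u).

Lemma measurable_clamp l u : measurable_fun setT (clamp l u).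
Proof. by apply: measurable_maxr => //; exact: measurable_minr. Qed.

Lemma clamp_id l u x : l <= x <= u -> clamp l u x = x.
Proof. by move=> /andP[lx xu]; rewrite /clamp min_l// max_r. Qed.

Lemma clamp_bounds l u x : l <= u -> l <= clamp l u x <= u.
Proof. by move=> lu; rewrite /clamp le_max lexx/= ge_max lu/= ge_min lexx orbT. Qed.

Lemma clamp_incr l u a b : a <= b ->
  0 <= clamp l u b - clamp l u a <= b - a.
Proof.
move=> ab; rewrite /clamp.
have : Num.min a u <= Num.min b u <= Num.min a u + (b - a).
  by case: (leP a u) => au; case: (leP b u) => bu; apply/andP; split; lra.
move: (Num.min a u) (Num.min b u) => s t /andP[st ts].
by case: (leP l s) => ls; case: (leP l t) => lt; apply/andP; split; lra.
Qed.

Lemma clamp_incr_mul_le l u w y : y * (clamp l u (w + y) - clamp l u w) <= y ^+ 2.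
Proof.
have [y0|y0] := leP 0 y.
  have /andP[] := @clamp_incr l u w (w + y) ltac:(by rewrite lerDl).
  by move: (clamp _ _ _ - _) => k; nra.
have /andP[] := @clamp_incr l u (w + y) w ltac:(by rewrite gerDl ltW).
by move: (clamp _ _ _) (clamp _ _ _) => k k'; nra.
Qed.

(** From a point of [[a, b]] there is room [e] on both sides before the clamp acts, so the increment
    has size at least [min |y| e]. Elsewhere monotonicity of the clamp gives the right sign. *)
Lemma clamp_incr_mul_ge a b e w y : 0 <= e ->
  (a <= w <= b)%R%:R * (`|y| * Num.min `|y| e) <=
  y * (clamp (a - e) (b + e) (w + y) - clamp (a - e) (b + e) w).
Proof.
move=> e0; have [wab|_] := boolP (a <= w <= b); last first.
  rewrite mul0r; have [y0|y0] := leP 0 y.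
    by rewrite mulr_ge0//; have /andP[] := @clamp_incr (a - e) (b + e) w (w + y)
      ltac:(by rewrite lerDl).
  rewrite mulr_le0//; first exact: ltW.
  have /andP[] := @clamp_incr (a - e) (b + e) (w + y) w ltac:(by rewrite gerDl ltW).
  by rewrite subr_ge0 subr_le0.
rewrite mul1r; move/andP: wab => [aw wb].
rewrite (@clamp_id _ _ w); last by apply/andP; split; lra.
have [y0|y0] := ger0P y.
  rewrite ler_wpM2l// /clamp.
  have [h1|h1] := leP (w + y) (b + e); have [h2|h2] := leP y e;
    by rewrite max_r; lra.
rewrite -[leRHS]mulrNN ler_wpM2l//; first lra.
rewrite /clamp opprB (@min_l _ _ (w + y)); last lra.
by case: (leP (- y) e) => h2; case: (leP (a - e) (w + y)) => h3; lra.
Qed.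

End Clamp.

Section Numerics.
Context {R : realType}.

(* [b2] and [b3] are the contributions of the large and of the small jumps to the
   truncated moment, [m] the coefficient of the third moment for negative
   (25/32) and positive (3/8/q) jumps, and [3/5 * b3] the width of the
   concentration window. *)
Lemma stein_numeric (b2 b3 m : R) : 0 <= b2 -> 0 <= b3 ->
  37 / 20 * (b2 + b3) <= 1 -> let q := 7 / 12 - b2 in
  m = 25 / 32 \/ m = 3 / 8 / q ->
  b2 + m * b3 + 3 / 5 * b3 / q * (1 - b2) <= 37 / 20 * (b2 + b3).
Proof.
move=> b20 b30 b23 q mE.
have q0 : 0 < q by rewrite /q; lra.
suff : (b2 + m * b3 + 3 / 5 * b3 / q * (1 - b2)) * q <=
  37 / 20 * (b2 + b3) * q by rewrite ler_pM2r.
have -> : (b2 + m * b3 + 3 / 5 * b3 / q * (1 - b2)) * q =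
    b2 * q + m * q * b3 + 3 / 5 * b3 * (1 - b2).
  by field; rewrite gt_eqF.
have mq : m * q = 25 / 32 * q \/ m * q = 3 / 8.
  by case: mE => ->; [left|right]; rewrite // divfK// gt_eqF.
have h1 : 0 <= b2 * (20 / 37 - b2 - b3) by rewrite mulr_ge0//; lra.
have h2 : 0 <= b3 * (20 / 37 - b2 - b3) by rewrite mulr_ge0//; lra.
have h3 := mulr_ge0 b20 b30; have h4 := mulr_ge0 b30 b30.
(* [h1] and [h2] turn the linear terms into quadratic ones. When [m * q = 3 / 8] a negative multiple
   of [b2 * b3] is left over, and this square absorbs it. *)
have h5 := sqr_ge0 (3 * b2 - 4 * b3).
by case: mq => ->; rewrite /q; lra.
Qed.

End Numerics.

(** * Stein's method for a variable satisfying the Mecke identity *)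

Section SteinMethod.
Context {R : realType}.
Context d1 (T1 : measurableType d1) (Q : probability T1 R) (W : T1 -> R).
Context d2 (T2 : measurableType d2) (mu : probability T2 R) (Y : T2 -> R).
Variable lam : R.
Hypotheses (mW : measurable_fun setT W) (mY : measurable_fun setT Y).
Hypothesis lam0 : 0 < lam.
Hypothesis iW : Q.-integrable setT (EFin \o W).
Hypothesis iY2 : mu.-integrable setT (EFin \o (fun y => Y y ^+ 2)).
Hypothesis EY : \int[mu]_y Y y = 0.
Hypothesis EY2 : lam * \int[mu]_y (Y y ^+ 2) = 1.
Hypothesis mecke : forall (f : R -> R) (M : R), measurable_fun setT f ->
  (forall x, `|f x| <= M) ->
  \int[Q]_w (W w * f (W w)) =
  lam * \int[mu]_y (Y y * \int[Q]_w f (W w + Y y)).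

Let iY : mu.-integrable setT (EFin \o Y).
Proof. exact: integrable_sqr. Qed.

Let measurable_shift (f : R -> R) (M : R) : measurable_fun setT f -> (forall x, `|f x| <= M) ->
  measurable_fun setT (fun y => \int[Q]_w f (W w + Y y)).
Proof.
move=> mf fM.
apply: (@measurable_Rintegral_bounded _ _ T1 T2 R Q (fun p => f (W p.1 + Y p.2)) M) => //.
apply: measurableT_comp => //.
by apply: measurable_funD; apply: measurableT_comp.
Qed.

Let mfW (f : R -> R) (y : T2) : measurable_fun setT f ->
  measurable_fun setT (fun w => f (W w + Y y)).
Proof. by move=> mf; apply: measurableT_comp => //; exact: measurable_funD. Qed.

Let shift_bounded (f : R -> R) (M : R) y : measurable_fun setT f ->
  (forall x, `|f x| <= M) -> `|\int[Q]_w f (W w + Y y)| <= M.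
Proof.
by move=> mf fM; apply: normr_Rintegral_bounded => //; exact: mfW.
Qed.

Let integrable_shift (f : R -> R) (M : R) : measurable_fun setT f ->
  (forall x, `|f x| <= M) ->
  mu.-integrable setT (EFin \o (fun y => Y y * \int[Q]_w f (W w + Y y))).
Proof.
move=> mf fM; apply: (@integrable_dominated _ _ _ _ _ (fun y => M * `|Y y|)).
- by apply: measurable_funM => //; exact: measurable_shift fM.
- by apply: integrableMl_fun; exact: integrable_norm.
- by move=> y; rewrite normrM mulrC ler_wpM2r// (shift_bounded _ mf fM).
Qed.

(** As [Y] has mean zero, the constant [E f(W)] may be subtracted inside. This leaves increments of
    [f] over a jump, of second order in [Y] once multiplied by [Y]. *)
Let mecke_centered (f : R -> R) (M : R) : measurable_fun setT f ->
  (forall x, `|f x| <= M) ->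
  let g y := \int[Q]_w (Y y * (f (W w + Y y) - f (W w))) in
  mu.-integrable setT (EFin \o g) /\
  \int[Q]_w (W w * f (W w)) = lam * \int[mu]_y g y.
Proof.
move=> mf fM g.
have ifW : Q.-integrable setT (EFin \o (fun w => f (W w))).
  by apply: (integrable_bounded Q _ (fun w => fM _)); exact: measurableT_comp.
have ifWY y : Q.-integrable setT (EFin \o (fun w => f (W w + Y y))).
  exact: (integrable_bounded Q (mfW y mf) (fun w => fM _)).
have gE : g = fun y => Y y * \int[Q]_w f (W w + Y y) - \int[Q]_w f (W w) * Y y.
  apply/funext => y; rewrite /g RintegralZl//; last exact: integrableB_fun.
  by rewrite RintegralB// mulrBr [_ * Y y]mulrC.
have i1 := integrable_shift mf fM.
have i2 := integrableMl_fun (\int[Q]_w f (W w)) iY.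
split; first by rewrite gE; exact: integrableB_fun.
by rewrite (mecke mf fM) gE RintegralB// RintegralZl// EY mulr0 subr0.
Qed.

Let EW : \int[Q]_w W w = 0.
Proof.
have n1 (x : R) : `|cst (1 : R) x| <= 1 by rewrite normr1.
have [_ e] := mecke_centered (measurable_cst (1 : R)) n1.
transitivity (\int[Q]_w (W w * cst 1 (W w))).
  by apply: eq_Rintegral => w _; rewrite mulr1.
rewrite e (_ : (fun y => _) = cst 0); first by rewrite Rintegral_cst_prob mulr0.
apply/funext => y; transitivity (\int[Q]_w (0 : R)); last exact: Rintegral_cst_prob.
by apply: eq_Rintegral => w _; rewrite subrr mulr0.
Qed.

(** Replaces the inequality [E |W| <= sqrt (E W^2)], since the identity function is not a bounded
    test function. With [f] the clamp to [[-2, 2]], pointwise [2 |x| <= 1 + x f(x)], and the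
    identity gives [E W f(W) <= l E Y^2 = 1]. For a clamp level below 2 the pointwise inequality
    fails at large [x]. *)
Let EabsW : \int[Q]_w `|W w| <= 1.
Proof.
pose f := @clamp R (- 2) 2.
have mf : measurable_fun setT f by exact: measurable_clamp.
have f2 x : `|f x| <= 2 by rewrite ler_norml clamp_bounds//; lra.
have [ig eg] := mecke_centered mf f2.
have iabs : Q.-integrable setT (EFin \o (fun w => `|W w|)) by exact: integrable_norm.
have iWf : Q.-integrable setT (EFin \o (fun w => W w * f (W w))).
  apply: (@integrable_dominated _ _ _ _ _ (fun w => 2 * `|W w|)).
  - by apply: measurable_funM => //; exact: measurableT_comp.
  - exact: integrableMl_fun.
  - by move=> w; rewrite normrM mulrC ler_wpM2r.
have le1 : \int[Q]_w (W w * f (W w)) <= 1.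
  rewrite eg -EY2 ler_pM2l//; apply: le_Rintegral => // y _.
  rewrite -[leRHS](Rintegral_cst_prob Q); apply: le_Rintegral => //.
  - apply: integrableMl_fun; apply: integrableB_fun.
      exact: (integrable_bounded Q (mfW y mf) (fun w => f2 _)).
    by apply: (integrable_bounded Q _ (fun w => f2 _)); exact: measurableT_comp.
  - exact: integrable_cst_fun.
  - by move=> w _; exact: clamp_incr_mul_le.
have : \int[Q]_w (2 * `|W w|) <= \int[Q]_w (1 + W w * f (W w)).
  apply: le_Rintegral => //; first exact: integrableMl_fun.
    exact: integrableD_fun (integrable_cst_fun _ _) iWf.
  move=> w _; move: (W w) => x; rewrite /f /clamp.
  have m2 : Num.max (- 2) 2 = 2 :> R by rewrite max_r//; lra.
  have s1 := sqr_ge0 (x - 1); have s2 := sqr_ge0 (x + 1).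
  by case: (ger0P x) => x0; case: (leP x 2) => h1; rewrite ?m2;
    try (case: (leP (- 2) x) => h2); nra.
rewrite RintegralZl// RintegralD//; last exact: integrable_cst_fun.
by rewrite Rintegral_cst_prob; lra.
Qed.

Let b2 := lam * \int[mu]_y (Y y ^+ 2 * (1 < `|Y y|)%R%:R).
Let b3 := lam * \int[mu]_y (`|Y y| ^+ 3 * (`|Y y| <= 1)%R%:R).

Let mnY : measurable_fun setT (fun y => `|Y y|).
Proof. exact: measurableT_comp. Qed.

Let iB2 : mu.-integrable setT (EFin \o (fun y => Y y ^+ 2 * (1 < `|Y y|)%R%:R)).
Proof.
apply: integrable_dominated iY2 _.
  apply: measurable_funM; first exact: measurable_funX.
  by apply: measurable_natr_bool; exact: measurable_fun_ltr.
by move=> y; rewrite (le_trans (ler_normM_bool _ _))// ger0_norm// sqr_ge0.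
Qed.

Let iB1 : mu.-integrable setT (EFin \o (fun y => Y y ^+ 2 * (`|Y y| <= 1)%R%:R)).
Proof.
apply: integrable_dominated iY2 _.
  apply: measurable_funM; first exact: measurable_funX.
  by apply: measurable_natr_bool; exact: measurable_fun_ler.
by move=> y; rewrite (le_trans (ler_normM_bool _ _))// ger0_norm// sqr_ge0.
Qed.

Let iB3 : mu.-integrable setT (EFin \o (fun y => `|Y y| ^+ 3 * (`|Y y| <= 1)%R%:R)).
Proof.
apply: integrable_dominated iY2 _.
  apply: measurable_funM; first exact: measurable_funX.
  by apply: measurable_natr_bool; exact: measurable_fun_ler.
move=> y; have [h|_] := leP `|Y y| 1; last by rewrite mulr0n mulr0 normr0 sqr_ge0.
by rewrite mulr1n mulr1 normrX normr_id exprS -[Y y ^+ 2]real_normK ?num_real// ler_piMl ?exprn_ge0.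
Qed.

Let B1E : lam * \int[mu]_y (Y y ^+ 2 * (`|Y y| <= 1)%R%:R) = 1 - b2.
Proof.
rewrite -[X in _ = X - _]EY2 /b2 -mulrBr -RintegralB//; congr (_ * _).
apply: eq_Rintegral => y _.
by case: (leP `|Y y| 1) => _; rewrite ?(mulr1n, mulr0n) ?(mulr1, mulr0) ?subr0 ?subrr.
Qed.

Let b2_ge0 : 0 <= b2.
Proof.
by apply: mulr_ge0; [exact: ltW|apply: Rintegral_ge0 => y _; rewrite mulr_ge0 ?sqr_ge0].
Qed.

Let b3_ge0 : 0 <= b3.
Proof.
by apply: mulr_ge0; [exact: ltW|apply: Rintegral_ge0 => y _; rewrite mulr_ge0 ?exprn_ge0].
Qed.

Let indW a b : Q.-integrable setT (EFin \o (fun w => (a <= W w <= b)%R%:R : R)).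
Proof.
apply: (@integrable_bounded _ _ _ _ _ 1) => [|w].
  apply: measurable_natr_bool; apply: measurable_and; exact: measurable_fun_ler.
by rewrite ger0_norm; case: (_ && _).
Qed.

(* The Mecke identity for the identity clamped to [[a - e, b + e]] and centred. *)
Let concentration a b e : a <= b -> 0 < e ->
  \int[Q]_w (a <= W w <= b)%R%:R * (1 - b2 - b3 / (4 * e)) <= (b - a) / 2 + e.
Proof.
move=> ab e0; set p := \int[Q]_w _; set M := _ + e.
(* After centring, [|h|] is at most [M], half the length of the enlarged interval; so
   [E W h(W) <= M] by [EabsW]. *)
pose h x := clamp (a - e) (b + e) x - (a + b) / 2.
have mh : measurable_fun setT h by apply: measurable_funB => //; exact: measurable_clamp.
have hM x : `|h x| <= M.
  have /andP[] : a - e <= clamp (a - e) (b + e) x <= b + e by apply: clamp_bounds; lra.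
  by rewrite /h /M ler_norml; move: (clamp _ _ _) => t ? ?; apply/andP; split; lra.
have [ig eg] := mecke_centered mh hM.
have iWh : Q.-integrable setT (EFin \o (fun w => W w * h (W w))).
  apply: (@integrable_dominated _ _ _ _ _ (fun w => M * `|W w|)).
  - by apply: measurable_funM => //; exact: measurableT_comp.
  - by apply: integrableMl_fun; exact: integrable_norm.
  - by move=> w; rewrite normrM mulrC ler_wpM2r.
apply: (@le_trans _ _ (\int[Q]_w (W w * h (W w)))); last first.
  have M0 : 0 <= M by apply: le_trans (hM 0).
  apply: (@le_trans _ _ (M * \int[Q]_w `|W w|)); last by rewrite ler_piMr.
  rewrite -RintegralZl//; last exact: integrable_norm.
  apply: le_Rintegral => //; first by apply: integrableMl_fun; exact: integrable_norm.
  move=> w _; rewrite (le_trans (ler_norm _))// normrM mulrC ler_wpM2r//.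
rewrite eg; pose q y := p * (Y y ^+ 2 * (`|Y y| <= 1)%R%:R
                            - (4 * e)^-1 * (`|Y y| ^+ 3 * (`|Y y| <= 1)%R%:R)).
have p0 : 0 <= p by exact: Rintegral_ge0.
have -> : p * (1 - b2 - b3 / (4 * e)) = lam * \int[mu]_y q y.
  rewrite RintegralZl//; last by apply: integrableB_fun => //; exact: integrableMl_fun.
  rewrite RintegralB//; last exact: integrableMl_fun.
  by rewrite RintegralZl// -B1E /b3; ring.
rewrite ler_pM2l//; apply: le_Rintegral => //.
  by apply: integrableMl_fun; apply: integrableB_fun => //; exact: integrableMl_fun.
move=> y _; apply: (@le_trans _ _ (p * (`|Y y| * Num.min `|Y y| e))).
  rewrite /q ler_wpM2l// -[Y y ^+ 2]real_normK ?num_real//.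
  move: (normr_ge0 (Y y)); move: `|Y y| => t t0.
  have [t1|t1] := leP t 1; last by rewrite mulr0n !mulr0 subr0 mulr_ge0// le_min t0 ltW.
  (* [t - t ^+ 2 / (4 * e)] is a minorant of [min t e], touching the level [e] at [t = 2 * e]. It
     trades the truncation at [e] for second and third moments. *)
  rewrite mulr1n !mulr1 (_ : _ - _ = t * (t - t ^+ 2 / (4 * e))); last by field; rewrite gt_eqF.
  rewrite ler_wpM2l// le_min; apply/andP; split.
    by rewrite gerBl divr_ge0 ?sqr_ge0// mulr_ge0// ltW.
  rewrite lerBlDr -lerBlDl ler_pdivlMr; last by rewrite mulr_gt0.
  by have := sqr_ge0 (t - 2 * e); nra.
rewrite -RintegralZr//; apply: le_Rintegral => //.
- apply: (@integrable_dominated _ _ _ _ _ (fun w => `|Y y| * Num.min `|Y y| e * (a <= W w <= b)%R%:R)).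
  + apply: measurable_funM => //; apply: measurable_natr_bool.
    by apply: measurable_and; exact: measurable_fun_ler.
  + exact: integrableMl_fun.
  + move=> w; rewrite mulrC ger0_norm// mulr_ge0// mulr_ge0// le_min normr_ge0; exact: ltW.
- apply: integrableMl_fun; apply: integrableB_fun.
    exact: (integrable_bounded Q (mfW y mh) (fun w => hM _)).
  by apply: (integrable_bounded Q _ (fun w => hM _)); exact: measurableT_comp.
- move=> w _; apply: (le_trans (@clamp_incr_mul_ge _ a b e (W w) (Y y) (ltW e0))).
  by rewrite /h; lra.
Qed.

(** Ensures that a window margin proportional to [b3] is positive. For [0 <= t <= 1] one has
    [t^2 <= e^2 + t^3 / e]; so [b3 = 0] would force [1 - b2 <= lam * e ^+ 2] for every [e > 0]. *)
Let b3_gt0 : b2 < 1 -> 0 < b3.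
Proof.
move=> b21; rewrite lt0r b3_ge0 andbT; apply/eqP => b30.
have key e : 0 < e -> 1 - b2 <= lam * e ^+ 2.
  move=> e0; have -> : lam * e ^+ 2 = lam * e ^+ 2 + e^-1 * b3 by rewrite b30 mulr0 addr0.
  have -> : lam * e ^+ 2 + e^-1 * b3 = lam * \int[mu]_y
      (e ^+ 2 + e^-1 * (`|Y y| ^+ 3 * (`|Y y| <= 1)%R%:R)).
    rewrite (@RintegralD _ _ _ mu setT (fun=> e ^+ 2))//;
      [|exact: integrable_cst_fun|exact: integrableMl_fun].
    by rewrite (Rintegral_cst_prob mu (e ^+ 2)) RintegralZl// /b3; ring.
  rewrite -B1E.
  rewrite ler_pM2l//; apply: le_Rintegral => //.
    by apply: integrableD_fun; [exact: integrable_cst_fun|exact: integrableMl_fun].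
  move=> y _; rewrite -[Y y ^+ 2]real_normK ?num_real//.
  move: (normr_ge0 (Y y)); move: `|Y y| => t t0.
  case: (leP t 1) => t1; rewrite ?(mulr1n, mulr0n) ?(mulr1, mulr0); last first.
    by rewrite addr0 sqr_ge0.
  have [te|et] := leP t e.
    have : 0 <= e^-1 * t ^+ 3 by rewrite mulr_ge0 ?invr_ge0 ?exprn_ge0// ltW.
    by nra.
  have : t ^+ 2 <= e^-1 * t ^+ 3 by rewrite mulrC ler_pdivlMr// [t ^+ 3]exprSr ler_wpM2l ?exprn_ge0// ltW.
  by have := sqr_ge0 e; lra.
pose e := Num.min 1 ((1 - b2) / (2 * lam)).
have e0 : 0 < e by rewrite lt_min ltr01 divr_gt0 ?subr_gt0// mulr_gt0.
have := key e e0; rewrite leNgt => /negP; apply.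
have e1 : e <= 1 by rewrite ge_min lexx.
have e2 : e <= (1 - b2) / (2 * lam) by rewrite ge_min lexx orbT.
apply: (@le_lt_trans _ _ (lam * e)).
  by rewrite ler_pM2l// expr2 ler_piMl// ltW.
apply: (@le_lt_trans _ _ (lam * ((1 - b2) / (2 * lam)))); first by rewrite ler_pM2l.
by rewrite (_ : lam * _ = (1 - b2) / 2); [lra|field; rewrite gt_eqF].
Qed.

Let side_mean z : \int[Q]_w side_part z (W w) <= 1 / 2.
Proof.
have inW : Q.-integrable setT (EFin \o (fun w => `|W w|)) by exact: integrable_norm.
have half (s : R) : \int[Q]_w (2^-1 * (`|W w| + s * W w)) <= 1 / 2.
  rewrite RintegralZl//; last by apply: integrableD_fun => //; exact: integrableMl_fun.
  rewrite RintegralD//; last exact: integrableMl_fun.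
  by rewrite RintegralZl// EW; move: EabsW; lra.
have [z0|z0] := leP 0 z.
  rewrite (_ : (fun w => _) = fun w => 2^-1 * (`|W w| + 1 * W w))//.
  apply/funext => w; rewrite /side_part z0 mul1r.
  by case: ger0P => w0; rewrite ?(max_l w0) ?(max_r (ltW w0)); field.
rewrite (_ : (fun w => _) = fun w => 2^-1 * (`|W w| + (-1) * W w))//.
apply/funext => w; rewrite /side_part (lt_geF z0) mulN1r.
case: ger0P => w0; first by rewrite max_r ?oppr_le0//; field.
by rewrite max_l ?oppr_ge0 ?ltW//; field.
Qed.

Let window_mass z l : 0 <= l -> 37 / 20 * (b2 + b3) <= 1 ->
  \int[Q]_w (z - l <= W w <= z)%R%:R <= (l / 2 + 3 / 5 * b3) / (7 / 12 - b2).
Proof.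
move=> l0 small; have b30 := b3_ge0; have b31 : 0 < b3 by apply: b3_gt0; lra.
(* With [e = 3 / 5 * b3] the loss [b3 / (4 * e)] is [5 / 12], which leaves the factor
   [7 / 12 - b2]. *)
have := @concentration (z - l) z (3 / 5 * b3) ltac:(by rewrite gerBl) ltac:(by rewrite mulr_gt0).
rewrite subKr (_ : 1 - b2 - _ = 7 / 12 - b2); last first.
  by field; rewrite gt_eqF.
by rewrite -ler_pdivlMr//; lra.
Qed.

Lemma stein_upper_bound z :
  \int[Q]_w (W w <= z)%R%:R - Phi z <=
  37 / 20 * (lam * \int[mu]_y (Y y ^+ 2 * Num.min 1 `|Y y|)).
Proof.
have -> : lam * \int[mu]_y (Y y ^+ 2 * Num.min 1 `|Y y|) = b2 + b3.
  rewrite /b2 /b3 -mulrDr -RintegralD//; congr (_ * _); apply: eq_Rintegral => y _.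
  have [h|h] := leP `|Y y| 1; rewrite ?mulr1n ?mulr0n !mulr0 ?mulr1 ?addr0 ?add0r.
    by rewrite [`|Y y| ^+ 3]exprSr real_normK ?num_real.
  by [].
have iz : Q.-integrable setT (EFin \o (fun w => (W w <= z)%R%:R : R)).
  apply: (@integrable_bounded _ _ _ _ _ 1) => [|w].
    by apply: measurable_natr_bool; exact: measurable_fun_ler.
  by rewrite ger0_norm; case: (W w <= z).
(* A bound above 1 is trivial for a difference of probabilities. Otherwise [b2 <= 20 / 37 < 7 / 12],
   whence [q > 0] below. *)
have [small|big] := leP (37 / 20 * (b2 + b3)) 1; last first.
  apply: le_trans (ltW big); rewrite lerBlDr (@le_trans _ _ 1)//; last first.
    by rewrite lerDl Phi_ge0.
  rewrite -[leRHS](Rintegral_cst_prob Q); apply: le_Rintegral => //.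
    exact: integrable_cst_fun.
  by move=> w _; case: (W w <= z).
have sM x : `|stein z x| <= 17 / 16 by rewrite ger0_norm ?stein_ge0 ?stein_le.
have ms := measurable_stein z.
have [ig eg] := mecke_centered ms sM.
have iWs : Q.-integrable setT (EFin \o (fun w => W w * stein z (W w))).
  apply: (@integrable_dominated _ _ _ _ _ (fun w => 17 / 16 * `|W w|)).
  - by apply: measurable_funM => //; exact: measurableT_comp.
  - by apply: integrableMl_fun; exact: integrable_norm.
  - by move=> w; rewrite normrM mulrC ler_wpM2r.
have ids : Q.-integrable setT (EFin \o (fun w => dstein z (W w))).
  by apply: integrableB_fun; [exact: integrableD_fun|exact: integrable_cst_fun].
have isW : Q.-integrable setT (EFin \o (fun w => stein z (W w))).
  by apply: (integrable_bounded Q _ (fun w => sM _)); exact: measurableT_comp.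
have ibr y : Q.-integrable setT
    (EFin \o (fun w => Y y * (stein z (W w + Y y) - stein z (W w)))).
  apply: integrableMl_fun; apply: integrableB_fun => //.
  exact: (integrable_bounded Q (mfW y ms) (fun w => sM _)).
have iD y : Q.-integrable setT (EFin \o (fun w => stein_defect z (W w) (Y y))).
  by apply: integrableB_fun => //; exact: integrableMl_fun.
pose a := \int[Q]_w dstein z (W w).
pose I y := \int[Q]_w stein_defect z (W w) (Y y).
have IE : I = fun y => a * Y y ^+ 2 -
    \int[Q]_w (Y y * (stein z (W w + Y y) - stein z (W w))).
  apply/funext => y; rewrite /I RintegralB//; last exact: integrableMl_fun.
  by rewrite RintegralZl// mulrC.
have iI : mu.-integrable setT (EFin \o I).
  by rewrite IE; apply: integrableB_fun => //; exact: integrableMl_fun.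
(* The Stein equation integrated: [E dstein] may be multiplied by [lam * E Y^2 = 1], which brings it
   under the same integral over jumps as [E W f(W)]. *)
have -> : \int[Q]_w (W w <= z)%R%:R - Phi z = lam * \int[mu]_y I y.
  rewrite IE RintegralB//; last exact: integrableMl_fun.
  rewrite RintegralZl// mulrBr mulrCA EY2 mulr1 -eg /a.
  rewrite RintegralB//; [|exact: integrableD_fun|exact: integrable_cst_fun].
  by rewrite RintegralD// Rintegral_cst_prob; ring.
pose q := 7 / 12 - b2; pose C := 3 / 5 * b3 / q.
have b20 := b2_ge0; have b30 := b3_ge0.
have q0 : 0 < q by rewrite /q; lra.
(* Each jump has a single sign, so a maximum of the two coefficients suffices. [3 / 8 / q] and [C]
   collect the masses of the windows of lengths [Y] and [Y / 2]. *)
pose m : R := Num.max (25 / 32) (3 / 8 / q).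
have C0 : 0 <= C by rewrite divr_ge0 ?(ltW q0)// mulr_ge0.
have Ile y : I y <= Y y ^+ 2 * (1 < `|Y y|)%R%:R +
    (m * (`|Y y| ^+ 3 * (`|Y y| <= 1)%R%:R) + C * (Y y ^+ 2 * (`|Y y| <= 1)%R%:R)).
  have [h|h] := leP `|Y y| 1; rewrite ?mulr1n ?mulr0n !mulr0 ?mulr1 ?addr0 ?add0r; last first.
    rewrite -[leRHS](Rintegral_cst_prob Q); apply: le_Rintegral => //.
      exact: integrable_cst_fun.
    by move=> w _; exact: stein_defect_le_sqr.
  have [y0|/ltW y0] := leP 0 (Y y).
    apply: (@le_trans _ _ (\int[Q]_w (Y y ^+ 2 / 2 *
        ((z - Y y <= W w <= z)%R%:R + (z - Y y / 2 <= W w <= z)%R%:R)))).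
      apply: le_Rintegral => //.
        by apply: integrableMl_fun; exact: integrableD_fun.
      by move=> w _; exact: stein_defect_le_pos.
    rewrite RintegralZl//; last exact: integrableD_fun.
    rewrite RintegralD//.
    have h1 := @window_mass z (Y y) y0 small.
    have h2 := @window_mass z (Y y / 2) ltac:(by rewrite divr_ge0) small.
    rewrite ger0_norm//.
    apply: (@le_trans _ _ (3 / 8 / q * Y y ^+ 3 + C * Y y ^+ 2)); last first.
      by rewrite lerD2r ler_wpM2r ?exprn_ge0// le_max lexx orbT.
    have -> : 3 / 8 / q * Y y ^+ 3 + C * Y y ^+ 2 = Y y ^+ 2 / 2 *
      ((Y y / 2 + 3 / 5 * b3) / q + (Y y / 2 / 2 + 3 / 5 * b3) / q).
      by rewrite /C; field; rewrite gt_eqF.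
    by rewrite ler_wpM2l ?divr_ge0 ?sqr_ge0// lerD.
  have isp : Q.-integrable setT (EFin \o (fun w => side_part z (W w))).
    apply: (@integrable_dominated _ _ _ _ _ (fun w => `|W w|)).
    - apply: measurableT_comp => //; rewrite /side_part; case: (0 <= z);
        apply: measurable_maxr => //; exact: measurableT_comp.
    - exact: integrable_norm.
    - move=> w; rewrite ger0_norm ?side_part_ge0// /side_part.
      case: ifP => _; rewrite ge_max (normr_ge0 (W w)) andbT; first exact: ler_norm.
      by rewrite -(normrN (W w)); exact: ler_norm.
  apply: (@le_trans _ _ (\int[Q]_w (`|Y y| ^+ 3 / 2 * (17 / 16 + side_part z (W w))))).
    apply: le_Rintegral => //.
      by apply: integrableMl_fun; apply: integrableD_fun => //; exact: integrable_cst_fun.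
    by move=> w _; exact: stein_defect_le_neg.
  rewrite RintegralZl//; last by apply: integrableD_fun => //; exact: integrable_cst_fun.
  rewrite RintegralD//; last exact: integrable_cst_fun.
  rewrite Rintegral_cst_prob; have := side_mean z.
  have : 25 / 32 <= m by rewrite le_max lexx.
  have t3 : 0 <= `|Y y| ^+ 3 by rewrite exprn_ge0.
  have : 0 <= C * Y y ^+ 2 by rewrite mulr_ge0 ?sqr_ge0.
  by move: (Rintegral _ _ _) (C * _) (`|Y y| ^+ 3) t3 => u v t t3; nra.
apply: (@le_trans _ _ (b2 + m * b3 + C * (1 - b2))).
  rewrite -B1E /b2 /b3.
  apply: (@le_trans _ _ (lam * \int[mu]_y (Y y ^+ 2 * (1 < `|Y y|)%R%:R +
    (m * (`|Y y| ^+ 3 * (`|Y y| <= 1)%R%:R) + C * (Y y ^+ 2 * (`|Y y| <= 1)%R%:R))))).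
    rewrite ler_pM2l//; apply: le_Rintegral => //.
    by apply: integrableD_fun => //; apply: integrableD_fun; exact: integrableMl_fun.
  rewrite RintegralD//; last by apply: integrableD_fun; exact: integrableMl_fun.
  rewrite RintegralD//; [|exact: integrableMl_fun|exact: integrableMl_fun].
  by rewrite !RintegralZl//; lra.
apply: stein_numeric => //.
by rewrite /m -/q; case: leP => _; [right|left].
Qed.

End SteinMethod.

(** * Compound Poisson measures *)

Section RealFubini.
Context d1 d2 (T1 : measurableType d1) (T2 : measurableType d2) (R : realType).
Variables (m1 : probability T1 R) (m2 : probability T2 R).

Lemma integrable_fst (u : T1 -> R) : m1.-integrable setT (EFin \o u) ->
  (m1 \x m2)%E.-integrable setT (EFin \o (fun p => u p.1)).
Proof.
move=> iu; have mu : measurable_fun setT u.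
  by apply/measurable_EFinP; exact: measurable_int iu.
apply/integrable12ltyP => /=.
  by apply/measurable_EFinP; exact: measurableT_comp.
under eq_integral => x _ do rewrite integral_cst_prob.
by move/integrableP: iu => [].
Qed.

Lemma integrable_snd (u : T2 -> R) : m2.-integrable setT (EFin \o u) ->
  (m1 \x m2)%E.-integrable setT (EFin \o (fun p => u p.2)).
Proof.
move=> iu; have mu : measurable_fun setT u.
  by apply/measurable_EFinP; exact: measurable_int iu.
apply/integrable21ltyP => /=.
  by apply/measurable_EFinP; exact: measurableT_comp.
under eq_integral => x _ do rewrite integral_cst_prob.
by move/integrableP: iu => [].
Qed.

Variable F : T1 * T2 -> R.
Hypothesis iF : (m1 \x m2)%E.-integrable setT (EFin \o F).

Lemma Rintegral_prod12 : (forall x, m2.-integrable setT (EFin \o (fun y => F (x, y)))) ->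
  \int[(m1 \x m2)%E]_p F p = \int[m1]_x \int[m2]_y F (x, y).
Proof.
move=> i2; rewrite /Rintegral -(integral12_prod_meas1 iF); congr fine.
apply: eq_integral => x _; apply/esym/fineK.
by have := integrable_fin_num measurableT (i2 x).
Qed.

Lemma Rintegral_prod21 : (forall y, m1.-integrable setT (EFin \o (fun x => F (x, y)))) ->
  \int[(m1 \x m2)%E]_p F p = \int[m2]_y \int[m1]_x F (x, y).
Proof.
move=> i1; rewrite /Rintegral -(integral21_prod_meas1 iF); congr fine.
apply: eq_integral => y _; apply/esym/fineK.
by have := integrable_fin_num measurableT (i1 y).
Qed.

End RealFubini.

Section DiracIntegral.
Context d (T : measurableType d) (R : realType) (a : T).

Lemma Rintegral_dirac (f : T -> R) : measurable_fun setT f -> \int[\d_a]_x f x = f a.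
Proof.
move=> mf; rewrite /Rintegral integral_dirac//; last exact/measurable_EFinP.
by rewrite diracE in_setT mul1e.
Qed.

Lemma integrable_dirac (f : T -> R) : measurable_fun setT f ->
  (\d_a : {measure set T -> \bar R}).-integrable setT (EFin \o f).
Proof.
move=> mf; apply/integrableP; split; first exact/measurable_EFinP.
rewrite integral_dirac//; last exact/measurable_EFinP/measurableT_comp.
by rewrite diracE in_setT mul1e ltry.
Qed.

End DiracIntegral.

Lemma measurable_comp_addr (R : realType) (f : R -> R) (x : R) :
  measurable_fun setT f -> measurable_fun setT (fun s : R => f (s + x)).
Proof.
move=> mf; apply: (measurableT_comp mf (g := fun s : R => s + x)).
by apply: measurable_funD; [exact: measurable_id|exact: measurable_cst].
Qed.

Lemma measurable_comp_addl (R : realType) (f : R -> R) (x : R) :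
  measurable_fun setT f -> measurable_fun setT (fun s : R => f (x + s)).
Proof.
move=> mf; rewrite (_ : (fun s => _) = fun s => f (s + x)).
  exact: measurable_comp_addr.
by apply/funext => s; rewrite addrC.
Qed.

Lemma Rintegral_mul_add (R : realType) (nu : probability R R) (f : R -> R) (x : R) :
  nu.-integrable setT (EFin \o (fun s => s * f s)) ->
  nu.-integrable setT (EFin \o f) ->
  \int[nu]_s ((s + x) * f s) = \int[nu]_s (s * f s) + x * \int[nu]_s f s.
Proof.
move=> i1 i2; rewrite -RintegralZl// -RintegralD//; last exact: integrableMl_fun.
by apply: eq_Rintegral => s _; rewrite mulrDl.
Qed.

(** * Laws of sums of [k] independent jumps *)

Section ConvolutionPowers.
Context {R : realType}.
Variable mu : probability R R.

Definition sum_pair (p : R * R) : R := p.1 + p.2.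

Lemma measurable_sum_pair : measurable_fun setT sum_pair.
Proof. exact: measurable_funD. Qed.

HB.instance Definition _ := isMeasurableFun.Build _ _ _ _ sum_pair measurable_sum_pair.

Fixpoint conv_pow (k : nat) : probability R R :=
  if k is k'.+1 then distribution (conv_pow k' \x mu)%E (sum_pair : {mfun _ >-> _})
  else \d_(0 : R).

Hypothesis imu : mu.-integrable setT (EFin \o (fun x => x)).

Lemma integrable_conv_pow k : (conv_pow k).-integrable setT (EFin \o (fun x => x)).
Proof.
elim: k => [|k IH] /=.
  exact: integrable_dirac.
apply: integrable_pushforward => //; first exact/measurable_EFinP.
rewrite preimage_setT.
exact: (integrableD_fun (integrable_fst mu IH) (integrable_snd (conv_pow k) imu)).
Qed.

Lemma conv_pow_linear_integrable k (f : R -> R) (A B : R) : measurable_fun setT f ->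
  (forall s, `|f s| <= A + B * `|s|) -> (conv_pow k).-integrable setT (EFin \o f).
Proof.
move=> mf fAB; apply: (@integrable_dominated _ _ _ (conv_pow k) f (fun s => A + B * `|s|)) => //.
apply: integrableD_fun; first exact: integrable_cst_fun.
exact/integrableMl_fun/integrable_norm/integrable_conv_pow.
Qed.

(** Linear growth is allowed because the formula is applied to [s * h s] with [h] bounded and to the
    absolute value. *)
Lemma Rintegral_conv_powS k (f : R -> R) (A B : R) : measurable_fun setT f ->
  0 <= B -> (forall s, `|f s| <= A + B * `|s|) ->
  \int[conv_pow k.+1]_s f s = \int[mu]_x \int[conv_pow k]_s f (s + x).
Proof.
move=> mf B0 fAB.
have iF : (conv_pow k \x mu)%E.-integrable setT (EFin \o (f \o sum_pair)).
  apply: (@integrable_dominated _ _ _ (conv_pow k \x mu)%E _ (fun p => (A + B * `|p.1|) + B * `|p.2|)).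
  - exact: measurableT_comp.
  - have i1 : (conv_pow k).-integrable setT (EFin \o (fun s => A + B * `|s|)).
      apply: integrableD_fun; first exact: integrable_cst_fun.
      exact/integrableMl_fun/integrable_norm/integrable_conv_pow.
    have i2 : mu.-integrable setT (EFin \o (fun s => B * `|s|)).
      exact/integrableMl_fun/integrable_norm.
    exact: (integrableD_fun (integrable_fst mu i1) (integrable_snd (conv_pow k) i2)).
  - move=> p; apply: (le_trans (fAB _)); rewrite -addrA -mulrDr.
    by rewrite lerD2l ler_wpM2l// ler_normD.
transitivity (\int[(conv_pow k \x mu)%E]_p f (p.1 + p.2)).
  by rewrite /Rintegral integral_distribution//; exact/measurable_EFinP.
rewrite (Rintegral_prod21 iF)// => x.
apply: (@conv_pow_linear_integrable _ _ (A + B * `|x|) B).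
  exact: measurable_comp_addr.
move=> s; apply: (le_trans (fAB _)); rewrite -addrA -mulrDr lerD2l ler_wpM2l//.
by rewrite addrC ler_normD.
Qed.

Let smoothed k (h : R -> R) u := \int[conv_pow k]_s h (s + u).

Let measurable_smoothed k (h : R -> R) (M : R) : measurable_fun setT h -> (forall x, `|h x| <= M) ->
  measurable_fun setT (smoothed k h).
Proof.
move=> mh hM.
apply: (@measurable_Rintegral_bounded _ _ _ _ R (conv_pow k) (fun p => h (p.1 + p.2)) M) => //.
by apply: measurableT_comp => //; exact: measurable_funD.
Qed.

Let smoothed_bounded k (h : R -> R) (M : R) u : measurable_fun setT h -> (forall x, `|h x| <= M) ->
  `|smoothed k h u| <= M.
Proof.
move=> mh hM; apply: normr_Rintegral_bounded => //.
exact: measurable_comp_addr.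
Qed.

Let integrable_mul_bounded (h : R -> R) (M : R) : measurable_fun setT h ->
  (forall x, `|h x| <= M) -> mu.-integrable setT (EFin \o (fun x => x * h x)).
Proof.
move=> mh hM; apply: (@integrable_dominated _ _ _ mu _ (fun x => M * `|x|)).
- exact: measurable_funM.
- exact/integrableMl_fun/integrable_norm.
- by move=> x; rewrite normrM mulrC ler_wpM2r.
Qed.

(* Replaces the exchangeability of the summands: each of the [k.+1] summands
   contributes equally to the left-hand side. *)
Lemma Rintegral_conv_pow_mul k (h : R -> R) (M : R) : measurable_fun setT h ->
  (forall x, `|h x| <= M) ->
  \int[conv_pow k.+1]_s (s * h s) =
  k.+1%:R * \int[mu]_x (x * \int[conv_pow k]_s h (s + x)).
Proof.
elim: k h M => [|k IH] h M mh hM.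
  have M0 : 0 <= M by apply: le_trans (hM 0).
  rewrite (@Rintegral_conv_powS 0 (fun s => s * h s) 0 M) => //; last 2 first.
  - exact: measurable_funM.
  - by move=> s; rewrite add0r normrM mulrC ler_wpM2r.
  rewrite mul1r; apply: eq_Rintegral => x _.
  rewrite /= !Rintegral_dirac ?add0r//.
    exact: measurable_comp_addr.
  have mx : measurable_fun setT (fun s : R => s + x).
    exact: (@measurable_comp_addr R id x (@measurable_id _ _ setT)).
  exact: (measurable_funM mx (measurable_comp_addr x mh)).
have M0 : 0 <= M by apply: le_trans (hM 0).
have mhD (x : R) : measurable_fun setT (fun s : R => h (s + x)).
  exact: measurable_comp_addr.
have hDM x s : `|h (s + x)| <= M by exact: hM.
have ishD j x : (conv_pow j).-integrable setT (EFin \o (fun s => s * h (s + x))).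
  apply: (@conv_pow_linear_integrable _ _ 0 M).
    by apply: measurable_funM => //; exact: measurable_id.
  by move=> s; rewrite add0r normrM mulrC ler_wpM2r.
have ihD j x : (conv_pow j).-integrable setT (EFin \o (fun s => h (s + x))).
  exact: integrable_bounded (hDM x).
rewrite (@Rintegral_conv_powS k.+1 (fun s => s * h s) 0 M) => //; last 2 first.
- exact: measurable_funM.
- by move=> s; rewrite add0r normrM mulrC ler_wpM2r.
(* Here [x] is the last summand, [x'] the one singled out by the induction hypothesis, and
   [smoothed k h] averages over the other [k]. *)
pose G x x' := x' * smoothed k h (x' + x).
have step x : \int[conv_pow k.+1]_s ((s + x) * h (s + x)) =
    k.+1%:R * \int[mu]_x' G x x' + x * smoothed k.+1 h x.
  rewrite (@Rintegral_mul_add R (conv_pow k.+1) (fun s => h (s + x)) x (ishD k.+1 x) (ihD k.+1 x)).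
  congr (_ + _).
  apply: (etrans (IH (fun s => h (s + x)) M (mhD x) (hDM x))); congr (_ * _).
  apply: eq_Rintegral => x' _; congr (_ * _).
  by apply: eq_Rintegral => s _; rewrite addrA.
have ms := measurable_smoothed k mh hM.
have msS := measurable_smoothed k.+1 mh hM.
have iG : (mu \x mu)%E.-integrable setT (EFin \o (fun p => G p.1 p.2)).
  apply: (@integrable_dominated _ _ _ (mu \x mu)%E _ (fun p => M * `|p.2|)).
  - apply: measurable_funM => //; apply: measurableT_comp => //.
    exact: measurable_funD.
  - have i2 : mu.-integrable setT (EFin \o (fun s => M * `|s|)).
      exact/integrableMl_fun/integrable_norm.
    exact: (integrable_snd mu i2).
  - by move=> p; rewrite normrM mulrC ler_wpM2r// (smoothed_bounded _ _ mh hM).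
have iGx x : mu.-integrable setT (EFin \o (fun x' => G x x')).
  apply: (@integrable_mul_bounded (fun x' => smoothed k h (x' + x)) M).
    exact: measurable_comp_addr.
  by move=> x'; exact: smoothed_bounded mh hM.
have iGx' x' : mu.-integrable setT (EFin \o (fun x => G x x')).
  apply: integrableMl_fun; apply: (@integrable_bounded _ _ _ mu _ M).
    exact: measurable_comp_addl.
  by move=> x; exact: smoothed_bounded mh hM.
have iGG : mu.-integrable setT (EFin \o (fun x => \int[mu]_x' G x x')).
  apply: eq_integrable (integrable_fubini_F iG) => // x _.
  rewrite /fubini_F /=; apply/esym/fineK.
  by have := integrable_fin_num measurableT (iGx x).
have isS : mu.-integrable setT (EFin \o (fun x => x * smoothed k.+1 h x)).
  by apply: integrable_mul_bounded msS _ => x; exact: smoothed_bounded mh hM.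
under eq_Rintegral do rewrite step.
rewrite RintegralD//; last exact: integrableMl_fun.
rewrite RintegralZl// -(Rintegral_prod12 iG)// (Rintegral_prod21 iG)//.
(* After Fubini the summand [x] joins the other [k], so the term from the induction hypothesis is
   [k.+1] copies of the term of the last summand. *)
have -> : \int[mu]_x' \int[mu]_x G x x' = \int[mu]_x (x * smoothed k.+1 h x).
  apply: eq_Rintegral => x' _; rewrite /G RintegralZl//; last first.
    apply: (@integrable_bounded _ _ _ mu _ M).
      exact: measurable_comp_addl.
    by move=> x; exact: smoothed_bounded mh hM.
  congr (_ * _); rewrite /smoothed (@Rintegral_conv_powS k (fun s => h (s + x')) M 0)//.
    apply: eq_Rintegral => x _; apply: eq_Rintegral => s _.
    by congr h; rewrite addrAC -addrA.
  by move=> s; rewrite mul0r addr0.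
by rewrite -[in RHS]natr1 mulrDl mul1r.
Qed.

End ConvolutionPowers.

Section PoissonWeights.
Context {R : realType}.
Implicit Types lam : R.

Definition poisson_weight lam k := expR (- lam) * lam ^+ k / (k`!)%:R.

Lemma poisson_weight_ge0 lam k : 0 < lam -> 0 <= poisson_weight lam k.
Proof. by move=> l0; rewrite !mulr_ge0 ?expR_ge0 ?exprn_ge0 ?invr_ge0// ltW. Qed.

(** The Poisson shift identity, source of the factor [lam] in the Mecke identity. *)
Lemma poisson_weightS lam k :
  poisson_weight lam k.+1 * k.+1%:R = lam * poisson_weight lam k.
Proof.
rewrite /poisson_weight factS natrM exprS.
have a0 : k`!%:R != 0 :> R by rewrite pnatr_eq0 -lt0n fact_gt0.
have b0 : k.+1%:R != 0 :> R by rewrite pnatr_eq0.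
move: a0 b0; move: (k`!%:R) (k.+1%:R) => a b a0 b0.
by field; rewrite a0 b0.
Qed.

Lemma sum_poisson_weight lam : 0 < lam ->
  (\sum_(k <oo) (poisson_weight lam k)%:E = 1)%E.
Proof.
move=> l0; have : (poisson_prob lam 0 setT = 1)%E by exact: probability_setT.
rewrite /poisson_prob l0 -nneseries_esumT; last first.
  by move=> k; rewrite lee_fin poisson_pmf_ge0.
move=> <-; apply: eq_eseriesr => k _; congr EFin.
by rewrite /poisson_pmf l0 /poisson_weight; ring.
Qed.

Lemma psum_poisson_weight lam n : 0 < lam ->
  \sum_(0 <= k < n) poisson_weight lam k <= 1.
Proof.
move=> l0; rewrite -lee_fin -sumEFin -(sum_poisson_weight l0).
by apply: nneseries_lim_ge => k _ _; rewrite lee_fin poisson_weight_ge0.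
Qed.

End PoissonWeights.

(** * The compound Poisson law and its Mecke identity *)

Section CompoundPoisson.
Context {R : realType}.
Variables (mu : probability R R) (lam : R).
Hypothesis lam0 : 0 < lam.

Local Notation w := (poisson_weight lam).

Definition compound_poisson : set R -> \bar R :=
  mseries (fun k => mscale (NngNum (poisson_weight_ge0 k lam0)) (conv_pow mu k)) 0.

HB.instance Definition _ := Measure.on compound_poisson.

Lemma compound_poissonE A :
  (compound_poisson A = \sum_(k <oo) (w k)%:E * conv_pow mu k A)%E.
Proof. by []. Qed.

Let compound_poisson_setT : compound_poisson setT = 1%E.
Proof.
rewrite compound_poissonE -(sum_poisson_weight lam0); apply: eq_eseriesr => k _.
by rewrite -[RHS]mule1; congr (_ * _)%E; exact: probability_setT.
Qed.

HB.instance Definition _ :=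
  @Measure_isProbability.Build _ _ R compound_poisson compound_poisson_setT.

Lemma ge0_integral_compound_poisson (f : R -> \bar R) : measurable_fun setT f ->
  (forall s, 0 <= f s)%E ->
  (\int[compound_poisson]_s f s = \sum_(k <oo) (w k)%:E * \int[conv_pow mu k]_s f s)%E.
Proof.
move=> mf f0; rewrite ge0_integral_measure_series//; apply: eq_eseriesr => k _.
by rewrite ge0_integral_mscale.
Qed.

Hypothesis imu : mu.-integrable setT (EFin \o (fun x => x)).

Let c := \int[mu]_x `|x|.

Let absmoment_conv_pow k : \int[conv_pow mu k]_s `|s| <= k%:R * c.
Proof.
elim: k => [|k IH]; first by rewrite mul0r /= Rintegral_dirac// normr0.
have ik := integrable_norm (integrable_conv_pow imu k).
have im : mu.-integrable setT (EFin \o (fun x => `|x|)) by exact: integrable_norm.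
rewrite (@Rintegral_conv_powS _ _ imu k (fun s => `|s|) 0 1)//; last first.
  by move=> s; rewrite normr_id add0r mul1r.
have isx x : (conv_pow mu k).-integrable setT (EFin \o (fun s => `|s + x|)).
  apply: integrable_norm.
  exact: (integrableD_fun (integrable_conv_pow imu k) (integrable_cst_fun _ x)).
have le1 x : \int[conv_pow mu k]_s `|s + x| <= \int[conv_pow mu k]_s `|s| + `|x|.
  rewrite -[X in _ + X](Rintegral_cst_prob (conv_pow mu k)) -RintegralD//; last first.
    exact: integrable_cst_fun.
  apply: le_Rintegral => //.
    exact: (integrableD_fun ik (integrable_cst_fun _ _)).
  by move=> s _; exact: ler_normD.
apply: (@le_trans _ _ (\int[mu]_x (\int[conv_pow mu k]_s `|s| + `|x|))).
  apply: le_Rintegral => //.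
    have iF := integrable_norm (integrableD_fun
      (integrable_snd mu (integrable_conv_pow imu k))
      (integrable_fst (conv_pow mu k) imu)).
    apply: eq_integrable (integrable_fubini_F iF) => // x _.
    rewrite /fubini_F /=; apply/esym/fineK.
    by have := integrable_fin_num measurableT (isx x).
  exact: (integrableD_fun (integrable_cst_fun _ _) im).
rewrite RintegralD//; last exact: integrable_cst_fun.
by rewrite Rintegral_cst_prob -natr1 mulrDl mul1r lerD2r.
Qed.

Lemma integrable_compound_poisson :
  compound_poisson.-integrable setT (EFin \o (fun s => s)).
Proof.
apply/integrableP; split; first exact/measurable_EFinP.
rewrite ge0_integral_compound_poisson//; last first.
  exact/measurableT_comp/measurable_EFinP.
apply: (@le_lt_trans _ _ (lam * c)%:E); last exact: ltry.
apply: lime_le.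
  by apply: is_cvg_nneseries => k _ _; rewrite mule_ge0 ?lee_fin ?poisson_weight_ge0// integral_ge0.
apply: nearW => n.
apply: (@le_trans _ _ (\sum_(0 <= k < n) (w k * (k%:R * c))%:E)%E).
  apply: lee_sum => k _; rewrite [leRHS]EFinM; apply: lee_wpmul2l; first by rewrite lee_fin poisson_weight_ge0.
  have ik := integrable_norm (integrable_conv_pow imu k).
  rewrite -[leLHS]fineK; last by have := integrable_fin_num measurableT ik.
  by rewrite lee_fin; exact: absmoment_conv_pow.
rewrite sumEFin lee_fin.
have c0 : 0 <= c by exact: Rintegral_ge0.
case: n => [|n]; first by rewrite big_geq// mulr_ge0// ltW.
rewrite big_nat_recl// mul0r mulr0 add0r.
under eq_bigr => k _ do rewrite mulrA poisson_weightS mulrAC.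
by rewrite -mulr_sumr -[leRHS]mulr1 ler_wpM2l ?psum_poisson_weight// mulr_ge0// ltW.
Qed.

Let linear_integrable (f : R -> R) (A B : R) : measurable_fun setT f ->
  (forall s, `|f s| <= A + B * `|s|) -> compound_poisson.-integrable setT (EFin \o f).
Proof.
move=> mf fAB.
apply: (@integrable_dominated _ _ _ compound_poisson f (fun s => A + B * `|s|)) => //.
apply: integrableD_fun; first exact: integrable_cst_fun.
exact/integrableMl_fun/integrable_norm/integrable_compound_poisson.
Qed.

Let cvg_ge0 (f : R -> R) (A B : R) : measurable_fun setT f -> (forall s, 0 <= f s) ->
  (forall s, `|f s| <= A + B * `|s|) ->
  \sum_(0 <= k < n) (w k * \int[conv_pow mu k]_s f s) @[n --> \oo]
    --> \int[compound_poisson]_s f s.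
Proof.
move=> mf f0 fAB.
have ifk k := @conv_pow_linear_integrable _ _ imu k f A B mf fAB.
have iQ := linear_integrable mf fAB.
have fE n : (\sum_(0 <= k < n) (w k)%:E * \int[conv_pow mu k]_s (f s)%:E)%E =
    (\sum_(0 <= k < n) (w k * \int[conv_pow mu k]_s f s))%:E.
  rewrite -sumEFin; apply: eq_bigr => k _; rewrite [RHS]EFinM; congr (_ * _)%E.
  by rewrite fineK//; have := integrable_fin_num measurableT (ifk k).
have ge0 k : (0 <= (w k)%:E * \int[conv_pow mu k]_s (f s)%:E)%E.
  by rewrite mule_ge0 ?lee_fin ?poisson_weight_ge0// integral_ge0// => s _; rewrite lee_fin.
have h : ((\sum_(0 <= k < n) (w k * \int[conv_pow mu k]_s f s))%:E @[n --> \oo]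
    --> (\int[compound_poisson]_s f s)%:E)%E.
  under eq_fun do rewrite -fE.
  rewrite fineK; last by have := integrable_fin_num measurableT iQ.
  rewrite ge0_integral_compound_poisson; [|exact/measurable_EFinP|by move=> s; rewrite lee_fin].
  by apply: is_cvg_nneseries => k _ _.
by move/fine_cvgP : h => [].
Qed.

(** The series formula for the integral holds for nonnegative functions, so [f] is written as the
    difference of [f + |f|] and [|f|], both of linear growth. *)
Let cvg_linear (f : R -> R) (B : R) : measurable_fun setT f -> 0 <= B ->
  (forall s, `|f s| <= B + B * `|s|) ->
  \sum_(0 <= k < n) (w k * \int[conv_pow mu k]_s f s) @[n --> \oo]
    --> \int[compound_poisson]_s f s.
Proof.
move=> mf B0 fB.
pose g s := f s + `|f s|.
have mn : measurable_fun setT (fun s => `|f s|) by exact: measurableT_comp.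
have mg : measurable_fun setT g by exact: measurable_funD.
have g0 s : 0 <= g s by rewrite /g; have := ler_norm (- f s); rewrite normrN; lra.
have gB s : `|g s| <= 2 * B + 2 * B * `|s|.
  by rewrite (le_trans (ler_normD _ _))// normr_id; have := fB s; lra.
have nB s : `| `|f s| | <= B + B * `|s| by rewrite normr_id.
have h := cvgB (cvg_ge0 mg g0 gB) (cvg_ge0 mn (fun s => normr_ge0 _) nB).
have ifk k := @conv_pow_linear_integrable _ _ imu k f B B mf fB.
have iQ := linear_integrable mf fB.
have fE : f = fun s => g s - `|f s| by apply/funext => s; rewrite /g addrK.
have -> : \int[compound_poisson]_s f s =
    \int[compound_poisson]_s g s - \int[compound_poisson]_s `|f s|.
  rewrite -RintegralB//; [|exact: linear_integrable mg gB|exact: integrable_norm].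
  by congr (Rintegral _ _ _).
have -> : (fun n => \sum_(0 <= k < n) (w k * \int[conv_pow mu k]_s f s)) =
    (fun n => \sum_(0 <= k < n) (w k * \int[conv_pow mu k]_s g s)) -
    (fun n => \sum_(0 <= k < n) (w k * \int[conv_pow mu k]_s `|f s|)).
  apply/funext => n.
  transitivity (\sum_(0 <= k < n) (w k * \int[conv_pow mu k]_s g s) -
    \sum_(0 <= k < n) (w k * \int[conv_pow mu k]_s `|f s|)); last by [].
  rewrite -sumrB; apply: eq_bigr => k _.
  rewrite -mulrBr -RintegralB//; last exact: integrable_norm (ifk k).
    by congr (_ * _); apply: eq_Rintegral => s _; rewrite /g addrK.
  exact: (integrableD_fun (ifk k) (integrable_norm (ifk k))).
exact: h.
Qed.

(** A termwise comparison of series: by [Rintegral_conv_pow_mul] and [poisson_weightS], term [k.+1]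
    on the left is [lam] times term [k] on the right. Term 0 on the left vanishes, hence the shift
    of index in [cS1]. *)
Lemma compound_poisson_mecke (h : R -> R) (M : R) : measurable_fun setT h ->
  (forall x, `|h x| <= M) ->
  \int[compound_poisson]_s (s * h s) =
  lam * \int[mu]_x (x * \int[compound_poisson]_s h (s + x)).
Proof.
move=> mh hM; have M0 : 0 <= M by apply: le_trans (hM 0).
pose F (p : R * R) := p.2 * h (p.1 + p.2).
pose G s := \int[mu]_x F (s, x).
have iM : mu.-integrable setT (EFin \o (fun x => M * `|x|)).
  exact/integrableMl_fun/integrable_norm.
have mF : measurable_fun setT F.
  by apply: measurable_funM => //; apply: measurableT_comp => //; exact: measurable_funD.
have FM p : `|F p| <= M * `|p.2| by rewrite normrM mulrC ler_wpM2r.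
have iF (nu : probability R R) : (nu \x mu)%E.-integrable setT (EFin \o F).
  exact: (integrable_dominated mF (integrable_snd nu iM) FM).
have i2 s : mu.-integrable setT (EFin \o (fun x => F (s, x))).
  apply: (@integrable_dominated _ _ _ mu (fun x => F (s, x)) (fun x => M * `|x|)) => //.
    exact: (measurable_funM (@measurable_id _ _ setT) (measurable_comp_addl s mh)).
have i1 (nu : probability R R) (x : R) :
    nu.-integrable setT (EFin \o (fun s => F (s, x))).
  apply: integrableMl_fun; apply: (@integrable_bounded _ _ _ nu _ M) => //.
  exact: measurable_comp_addr.
have swap (nu : probability R R) :
    \int[nu]_s G s = \int[mu]_x (x * \int[nu]_s h (s + x)).
  rewrite /G -(Rintegral_prod12 (iF nu))// (Rintegral_prod21 (iF nu))//.
  apply: eq_Rintegral => x _; rewrite /F /= RintegralZl//.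
  by apply: (@integrable_bounded _ _ _ nu _ M) => //; exact: measurable_comp_addr.
have c0 : 0 <= c by exact: Rintegral_ge0.
have mG : measurable_fun setT G.
  apply/measurable_EFinP; apply: (@measurable_int _ _ _ mu).
  apply: eq_integrable (integrable_fubini_F (iF mu)) => // s _.
  rewrite /fubini_F /=; apply/esym/fineK.
  by have := integrable_fin_num measurableT (i2 s).
have GM s : `|G s| <= M * c.
  rewrite /G (le_trans (le_normr_Rintegral measurableT (i2 s)))// /c -RintegralZl//;
    last exact: integrable_norm.
  by apply: le_Rintegral => //; exact: integrable_norm.
have Mc : 0 <= M * c by rewrite mulr_ge0.
rewrite -[X in _ = _ * X]swap.
have cG : \sum_(0 <= k < n) (w k * \int[conv_pow mu k]_s G s) @[n --> \oo]
    --> \int[compound_poisson]_s G s.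
  apply: (cvg_linear mG Mc) => s.
  by apply: le_trans (GM s) _; rewrite lerDl mulr_ge0.
have cS : \sum_(0 <= k < n) (w k * \int[conv_pow mu k]_s (s * h s)) @[n --> \oo]
    --> \int[compound_poisson]_s (s * h s).
  apply: (@cvg_linear _ M) => // [|s]; first exact: measurable_funM.
  by rewrite normrM mulrC (le_trans (ler_wpM2r _ (hM s)))// lerDr.
have cS1 : \sum_(0 <= k < n.+1) (w k * \int[conv_pow mu k]_s (s * h s)) @[n --> \oo]
    --> \int[compound_poisson]_s (s * h s).
  by have := cS; rewrite -cvg_shiftS.
apply: (cvg_unique _ cS1) => //.
rewrite (_ : (fun n => _) = fun n =>
    lam * \sum_(0 <= k < n) (w k * \int[conv_pow mu k]_s G s)).
  exact: cvgMr.
apply/funext => n; rewrite big_nat_recl// [X in X + _](_ : _ = 0) ?add0r; last first.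
  by rewrite /= Rintegral_dirac ?mul0r ?mulr0//; exact: measurable_funM.
rewrite mulr_sumr; apply: eq_bigr => k _.
rewrite (Rintegral_conv_pow_mul imu k mh hM) swap.
by rewrite [LHS]mulrA poisson_weightS [RHS]mulrA.
Qed.

End CompoundPoisson.

Lemma Rintegral_natr_bool d (T : measurableType d) (R : realType)
    (P : probability T R) (b : T -> bool) : measurable [set x | b x] ->
  \int[P]_x (b x)%:R = fine (P [set x | b x]).
Proof.
move=> mb; rewrite /Rintegral -[X in fine (P X)]setIT -integral_indic//.
congr fine; apply: eq_integral => x _; rewrite indicE; congr (_%:R%:E).
by congr nat_of_bool; apply/idP/idP; rewrite inE.
Qed.

Section CompoundPoissonNormalApproximation.
Context {R : realType}.
Variables (mu : probability R R) (lam sigma : R).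
Hypotheses (lam0 : 0 < lam) (sigma0 : 0 < sigma).
Hypothesis imu2 : mu.-integrable setT (EFin \o (fun x => x ^+ 2)).
Hypothesis mean0 : \int[mu]_x x = 0.
Hypothesis var : \int[mu]_x (x ^+ 2) = sigma ^+ 2.

Local Notation Q := (compound_poisson mu lam0).

Let imu : mu.-integrable setT (EFin \o (fun x => x)).
Proof. exact: integrable_sqr. Qed.

(* Both signs of the scale [a] are used: the negative one gives the lower bound. *)
Let scaled_bound (a z : R) : a ^+ 2 * (lam * sigma ^+ 2) = 1 ->
  \int[Q]_s (a * s <= z)%R%:R - Phi z <=
  37 / 20 * (lam * \int[mu]_x ((a * x) ^+ 2 * Num.min 1 `|a * x|)).
Proof.
move=> a1; have mM : measurable_fun setT (fun s : R => a * s).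
  exact: measurable_funM.
have sqrE : (fun x : R => (a * x) ^+ 2) = (fun x => a ^+ 2 * x ^+ 2).
  by apply/funext => x; rewrite exprMn.
apply: (stein_upper_bound mM mM lam0).
- exact/integrableMl_fun/integrable_compound_poisson.
- by rewrite sqrE; exact: integrableMl_fun.
- by rewrite RintegralZl// mean0 mulr0.
- by rewrite sqrE RintegralZl// var mulrCA a1.
move=> f M mf fM.
have mh : measurable_fun setT (fun s => f (a * s)) by exact: measurableT_comp.
have hM s : `|f (a * s)| <= M by exact: fM.
have ih : Q.-integrable setT (EFin \o (fun s => s * f (a * s))).
  apply: (@integrable_dominated _ _ _ Q _ (fun s => M * `|s|)).
  - exact: measurable_funM.
  - exact/integrableMl_fun/integrable_norm/integrable_compound_poisson.
  - by move=> s; rewrite normrM mulrC ler_wpM2r.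
transitivity (a * \int[Q]_s (s * f (a * s))).
  by rewrite -RintegralZl//; apply: eq_Rintegral => s _; rewrite mulrA.
rewrite (compound_poisson_mecke lam0 imu mh hM) mulrCA; congr (_ * _).
rewrite -RintegralZl//.
  apply: eq_Rintegral => x _; rewrite mulrA; congr (_ * _).
  by apply: eq_Rintegral => s _; rewrite mulrDr.
apply: (@integrable_dominated _ _ _ mu _ (fun x => M * `|x|)).
- apply: measurable_funM => //.
  apply: (@measurable_Rintegral_bounded _ _ _ _ R Q (fun p => f (a * (p.1 + p.2))) M) => //.
  by apply: measurableT_comp => //; apply: measurable_funM => //; exact: measurable_funD.
- exact/integrableMl_fun/integrable_norm.
- move=> x; rewrite normrM mulrC ler_wpM2r//; apply: normr_Rintegral_bounded => //.
  exact: (measurable_comp_addr x mh).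
Qed.

Lemma compound_poisson_normal_approx (u : R) :
  `|fine (Q `]-oo, u[) - Phi (u / (sigma * Num.sqrt lam))| <=
  37 / 20 / sigma ^+ 2 *
  \int[mu]_x (x ^+ 2 * Num.min 1 (`|x| / (sigma * Num.sqrt lam))).
Proof.
pose c := sigma * Num.sqrt lam.
have c0 : 0 < c by rewrite mulr_gt0// sqrtr_gt0.
have c2 : c ^+ 2 = lam * sigma ^+ 2 by rewrite exprMn sqr_sqrtr ?ltW// mulrC.
rewrite -/c; clearbody c.
have ig : mu.-integrable setT (EFin \o (fun x => x ^+ 2 * Num.min 1 (`|x| / c))).
  apply: (@integrable_dominated _ _ _ mu _ (fun x => x ^+ 2)) => //.
    apply: measurable_funM => //; apply: measurable_minr => //.
    apply: measurable_funM => //; exact: measurableT_comp.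
  move=> x; have m0 : 0 <= Num.min 1 (`|x| / c) by rewrite le_min ler01 divr_ge0// ltW.
  by rewrite normrM (ger0_norm m0) (ger0_norm (sqr_ge0 _)) ler_piMr ?sqr_ge0// ge_min lexx.
have rhsE (e : R) : `|e| = 1 ->
    37 / 20 * (lam * \int[mu]_x ((e / c * x) ^+ 2 * Num.min 1 `|e / c * x|)) =
    37 / 20 / sigma ^+ 2 * \int[mu]_x (x ^+ 2 * Num.min 1 (`|x| / c)).
  move=> e1; rewrite (_ : (fun x => _) = fun x => c ^- 2 * (x ^+ 2 * Num.min 1 (`|x| / c))).
    rewrite RintegralZl// c2; move: (Rintegral _ _ _) => t.
    by field; rewrite !gt_eqF.
  apply/funext => x; have e2 : e ^+ 2 = 1 by rewrite -[e ^+ 2]real_normK ?num_real// e1 expr1n.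
  have -> : `|e / c * x| = `|x| / c.
    by rewrite !normrM e1 mul1r normfV (gtr0_norm c0) mulrC.
  rewrite !exprMn e2; move: (Num.min _ _) => t.
  by field; rewrite gt_eqF.
have hyp (e : R) : `|e| = 1 -> (e / c) ^+ 2 * (lam * sigma ^+ 2) = 1.
  move=> e1; have e2 : e ^+ 2 = 1 by rewrite -[e ^+ 2]real_normK ?num_real// e1 expr1n.
  by rewrite exprMn e2 mul1r -c2 exprVn mulVf// expf_neq0// gt_eqF.
have mlt : measurable [set s : R | s < u] by rewrite -set_itvNyo.
have QltE : fine (Q `]-oo, u[) = \int[Q]_s (s < u)%R%:R.
  by rewrite Rintegral_natr_bool// set_itvNyo.
have ilt : Q.-integrable setT (EFin \o (fun s => (s < u)%R%:R : R)).
  apply: (@integrable_bounded _ _ _ Q _ 1) => [|s].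
    by apply: measurable_natr_bool; exact: measurable_fun_ltr.
  by rewrite ger0_norm; case: (s < u).
have ile (e v : R) : Q.-integrable setT (EFin \o (fun s => (e * s <= v)%R%:R : R)).
  apply: (@integrable_bounded _ _ _ Q _ 1) => [|s].
    by apply: measurable_natr_bool; apply: measurable_fun_ler => //; exact: measurable_funM.
  by rewrite ger0_norm; case: (e * s <= v).
rewrite ler_norml QltE; apply/andP; split; last first.
  rewrite -(rhsE 1 (normr1 _)).
  apply: le_trans (scaled_bound (u / c) (hyp 1 (normr1 _))).
  rewrite lerD2r; apply: le_Rintegral => // s _; rewrite ler_nat mul1r [_^-1 * _]mulrC.
  rewrite ler_pM2r ?invr_gt0//; case: (ltP s u) => // su; first by rewrite ltW.
have n1 : `|-1 : R| = 1 by rewrite normrN1.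
(* Reflection turns the event [s < u] into the complement of a closed half-line event, so the strict
   inequality costs nothing. *)
rewrite -(rhsE (-1) n1); have := scaled_bound (- (u / c)) (hyp (-1) n1).
rewrite PhiN (_ : \int[Q]_s _ = 1 - \int[Q]_s (s < u)%R%:R); first by lra.
rewrite -[X in X - _](Rintegral_cst_prob Q) -RintegralB//; last exact: integrable_cst_fun.
apply: eq_Rintegral => s _; rewrite mulNr mul1r mulNr lerN2 [_^-1 * _]mulrC ler_pM2r ?invr_gt0//.
by case: (ltP s u) => _; rewrite ?subrr ?subr0.
Qed.

End CompoundPoissonNormalApproximation.

(** * Random sums *)

Section PartialSums.
Context d (T : measurableType d) (R : realType) (P : probability T R).
Variable X : nat -> {RV P >-> R}.

Lemma measurable_Ssum k : measurable_fun setT (Ssum X k).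
Proof. by apply: measurable_sum => i; exact: measurable_funP. Qed.

Definition partial_sum_pair k (w : T) := (Ssum X k w, X k w).

Lemma measurable_partial_sum_pair k : measurable_fun setT (partial_sum_pair k).
Proof.
by apply/measurable_fun_pairP; split; [exact: measurable_Ssum|exact: measurable_funP].
Qed.

HB.instance Definition _ k :=
  isMeasurableFun.Build _ _ _ _ (partial_sum_pair k) (measurable_partial_sum_pair k).

Local Notation mu := (distribution P (X 0%N)).

(** Later [F] is the event that [N] equals [k]. Carrying it through the induction gives the law of
    [Ssum X k] on that event directly. *)
Variable F : set T.
Hypothesis mF : measurable F.
Hypothesis indF : forall (n : nat) (B : nat -> set R), (forall i, measurable (B i)) ->
  P (F `&` \bigcap_(i in `I_n) X i @^-1` B i) =
  (P F * \prod_(i < n) P (X i @^-1` B i))%E.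
Hypothesis idX : identically_distributed X.

Let measurable_tail k n (B : nat -> set R) : (forall i, measurable (B i)) ->
  measurable (\bigcap_(i in `I_n) X (k + i)%N @^-1` B i).
Proof.
move=> mB; apply: bigcap_measurableType => i _.
by rewrite -[_ @^-1` _]setTI; exact: measurable_funP.
Qed.

(* Only the pairs [(Ssum X k, X k)] need a joint law, so the uniqueness of
   measures on the plane suffices for the independence of [Ssum X k] from the
   remaining variables. *)
Lemma Ssum_conv_pow_joint k n (A : set R) (B : nat -> set R) :
  measurable A -> (forall i, measurable (B i)) ->
  P (F `&` (Ssum X k @^-1` A `&` \bigcap_(i in `I_n) X (k + i)%N @^-1` B i)) =
  (P F * conv_pow mu k A * \prod_(i < n) mu (B i))%E.
Proof.
elim: k n A B => [|k IH] n A B mA mB.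
  have S0 w : Ssum X 0 w = 0 by rewrite /Ssum big_ord0.
  have eqB : (\prod_(i < n) mu (B i))%E = (\prod_(i < n) P (X i @^-1` B i))%E.
    by apply: eq_bigr => i _; rewrite idX.
  rewrite eqB /= diracE; have [A0|A0] := boolP (0 \in A).
    rewrite mule1 -indF//; congr (P _); apply/seteqP; split => w /=.
      by move=> [Fw [_ h]].
    by move=> [Fw h]; split => //; split => //; rewrite S0; exact: set_mem.
  rewrite mule0 mul0e (_ : _ `&` _ = set0) ?measure0//.
  by apply/seteqP; split => w //= [_ [+ _]]; rewrite S0 => /mem_set; rewrite (negbTE A0).
pose E := F `&` \bigcap_(i in `I_n) X (k.+1 + i)%N @^-1` B i.
have mE : measurable E by apply: measurableI => //; exact: measurable_tail.
have finite_kappa : (P F * \prod_(i < n) mu (B i))%E \is a fin_num.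
  rewrite fin_numM ?fin_num_measure//.
  by apply: (big_ind (fun x => x \is a fin_num)) => // [x y|i _];
    [exact: fin_numM|exact: fin_num_measure].
have kappa0 : 0 <= fine (P F * \prod_(i < n) mu (B i))%E.
  by rewrite fine_ge0// mule_ge0// prode_ge0.
pose m1 := pushforward (mrestr P mE) (partial_sum_pair k : {mfun T >-> _}).
pose m2 := mscale (NngNum kappa0) (conv_pow mu k \x mu)%E.
have m12 C : measurable C -> m1 C = m2 C.
  apply: (measure_unique [set A1 `*` B1 | A1 in measurable & B1 in measurable]
    (fun=> setT)) => //.
  - exact: measurable_prod_measurableType.
  - move=> _ _ [A1 mA1 [B1 mB1 <-]] [A2 mA2 [B2 mB2 <-]]; rewrite -setXI.
    by exists (A1 `&` A2); [exact: measurableI|exists (B1 `&` B2); [exact: measurableI|]].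
  - by move=> _; exists setT => //; exists setT => //; rewrite setXTT.
  - by rewrite bigcup_const.
  - move=> _ [A1 mA1 [B1 mB1 <-]].
    transitivity (P F * \prod_(i < n) mu (B i) * (conv_pow mu k A1 * mu B1))%E; last first.
      by apply/esym; congr (_ * _)%E; [exact: fineK|exact: product_measure1E].
    (* On rectangles the induction hypothesis is used with [X k] as the first of [n.+1] tail
       variables. *)
    pose B' i := if i is i'.+1 then B i' else B1.
    have mB' i : measurable (B' i) by case: i.
    have IHE := IH n.+1 A1 B' mA1 mB'.
    rewrite big_ord_recl [X in (_ * X)%E]muleC muleACA /= in IHE.
    rewrite -IHE; congr (P _); apply/seteqP; split => w /=.
      move=> [[SA XB] [Fw h]]; split=> //; split=> // -[|i] /= ilt.
        by rewrite addn0.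
      by rewrite addnS -addSn; exact: h.
    move=> [Fw [SA h]]; split.
      by split => //; have := h 0%N isT; rewrite /= addn0.
    by split => // i ilt; have := h i.+1 ilt; rewrite /= addnS -addSn.
  - move=> _; change (P (partial_sum_pair k @^-1` setT `&` E) < +oo)%E.
    rewrite preimage_setT setTI (@le_lt_trans _ _ 1%E) ?ltry//.
    exact: probability_le1.
have -> : F `&` (Ssum X k.+1 @^-1` A `&` \bigcap_(i in `I_n) X (k.+1 + i)%N @^-1` B i) =
    (partial_sum_pair k) @^-1` (sum_pair @^-1` A) `&` E.
  have SE w : Ssum X k.+1 w = sum_pair (partial_sum_pair k w).
    by rewrite /Ssum big_ord_recr.
  by apply/seteqP; split => w /=; rewrite SE => -[h1 [h2 h3]].
transitivity (m1 (sum_pair @^-1` A)); first by [].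
rewrite m12; last by rewrite -[_ @^-1` _]setTI; exact: measurable_sum_pair.
rewrite [RHS]muleAC; congr (_ * _)%E; exact: fineK.
Qed.

Lemma Ssum_conv_pow k (A : set R) : measurable A ->
  P (F `&` Ssum X k @^-1` A) = (P F * conv_pow mu k A)%E.
Proof.
move=> mA; have := @Ssum_conv_pow_joint k 0 A (fun=> setT) mA (fun=> measurableT).
rewrite big_ord0 mule1 => <-; congr (P (_ `&` _)).
by apply/seteqP; split => w /=; [move=> h; split|case].
Qed.

End PartialSums.

Lemma measurable_inv_ge0 d (T : measurableType d) (R : realType) (f : T -> R) :
  measurable_fun setT f -> (forall x, 0 <= f x) ->
  measurable_fun setT (fun x => (f x)^-1).
Proof.
(* The real power [-1] is measurable and agrees with the inverse on nonnegative reals, both being 0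
   at 0. *)
move=> mf f0; rewrite (_ : (fun x => _) = fun x => f x `^ (-1)).
  exact: (measurableT_comp (measurable_powR _) mf).
by apply/funext => x; rewrite powR_inv1.
Qed.

Lemma measurable_sqrtr d (T : measurableType d) (R : realType) (f : T -> R) :
  measurable_fun setT f -> measurable_fun setT (fun x => Num.sqrt (f x)).
Proof.
move=> mf; apply: (measurableT_comp (continuous_measurable_fun _) mf).
exact: sqrt_continuous.
Qed.

Section MixedIntegrals.
Context {R : realType}.
Context d (T : measurableType d) (P : probability T R) (L : {RV P >-> R}).
Variable mu : probability R R.

Lemma measurable_mixed (f : R * R -> R) : measurable_fun setT f -> (forall p, 0 <= f p) ->
  measurable_fun setT (fun lam => \int[mu]_x (f (lam, x))%:E)%E.
Proof.
move=> mf f0.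
apply: (@measurable_fun_fubini_tonelli_F _ _ R R R mu (EFin \o f)); first exact/measurable_EFinP.
by move=> p; rewrite lee_fin.
Qed.

Lemma integral_mixed (f : R * R -> R) : measurable_fun setT f -> (forall p, 0 <= f p) ->
  (\int[distribution P L]_lam \int[mu]_x (f (lam, x))%:E =
   \int[P]_w \int[mu]_x (f (L w, x))%:E)%E.
Proof.
move=> mf f0; rewrite ge0_integral_distribution//.
- exact: measurable_mixed.
- by move=> lam; apply: integral_ge0 => x _; rewrite lee_fin.
Qed.

End MixedIntegrals.

Section TruncatedMoments.
Context {R : realType}.
Variable sigma : R.
Hypothesis sigma0 : 0 < sigma.

Let scale (p : R * R) : R := sigma * Num.sqrt p.1.

Let scale_ge0 p : 0 <= scale p.
Proof. by rewrite mulr_ge0 ?sqrtr_ge0// ltW. Qed.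

Let measurable_scale : measurable_fun setT scale.
Proof. by apply: measurable_funM => //; exact: measurable_sqrtr. Qed.

Let measurable_abs2 : measurable_fun setT (fun p : R * R => `|p.2|).
Proof. exact: measurableT_comp. Qed.

Definition truncated_moment (p : R * R) := p.2 ^+ 2 * Num.min 1 (`|p.2| / scale p).

Definition tail_moment (p : R * R) := p.2 ^+ 2 * (scale p <= `|p.2|)%R%:R.

Definition body_moment (p : R * R) := `|p.2| ^+ 3 / scale p * (`|p.2| < scale p)%R%:R.

Lemma truncated_moment_ge0 p : 0 <= truncated_moment p.
Proof. by rewrite mulr_ge0 ?sqr_ge0// le_min ler01 divr_ge0. Qed.

Lemma tail_moment_ge0 p : 0 <= tail_moment p.
Proof. by rewrite mulr_ge0 ?sqr_ge0. Qed.

Lemma body_moment_ge0 p : 0 <= body_moment p.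
Proof. by rewrite mulr_ge0// divr_ge0// exprn_ge0. Qed.

Lemma measurable_truncated_moment : measurable_fun setT truncated_moment.
Proof.
apply: measurable_funM; first exact: measurable_funX.
apply: measurable_minr => //; apply: measurable_funM => //.
exact: measurable_inv_ge0.
Qed.

Lemma measurable_tail_moment : measurable_fun setT tail_moment.
Proof.
apply: measurable_funM; first exact: measurable_funX.
by apply: measurable_natr_bool; exact: measurable_fun_ler.
Qed.

Lemma measurable_body_moment : measurable_fun setT body_moment.
Proof.
apply: measurable_funM; last by apply: measurable_natr_bool; exact: measurable_fun_ltr.
by apply: measurable_funM; [exact: measurable_funX|exact: measurable_inv_ge0].
Qed.

(* False for [lam <= 0], where [scale = 0] and division by it gives 0. *)
Lemma truncated_momentE lam x : 0 < lam ->
  truncated_moment (lam, x) = tail_moment (lam, x) + body_moment (lam, x).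
Proof.
move=> l0; have c0 : 0 < scale (lam, x) by rewrite mulr_gt0// sqrtr_gt0.
rewrite /truncated_moment /tail_moment /body_moment /=.
move: (scale (lam, x)) c0 => c c0.
have [h|h] := leP c `|x|; rewrite ?(mulr1n, mulr0n) !(mulr1, mulr0) ?addr0 ?add0r.
  by rewrite min_l ?mulr1// ler_pdivlMr// mul1r.
rewrite min_r; last by rewrite ler_pdivrMr// mul1r ltW.
by rewrite -[x ^+ 2]real_normK ?num_real// [_ ^+ 3]exprSr mulrA.
Qed.

End TruncatedMoments.

Lemma expectation_gt0 d (T : measurableType d) (R : realType) (P : probability T R)
  (L : T -> R) : (forall w, 0 < L w) -> P.-integrable setT (EFin \o L) ->
  0 < fine (\int[P]_w (L w)%:E)%E.
Proof.
move=> L0 iL.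
have ge0 : 0 <= fine (\int[P]_w (L w)%:E)%E.
  by rewrite fine_ge0// integral_ge0// => w _; rewrite lee_fin ltW.
rewrite lt0r ge0 andbT; apply/eqP => e0.
have int0 : (\int[P]_w `|(L w)%:E| = 0)%E.
  under eq_integral => w _ do rewrite gee0_abs ?lee_fin ?(ltW (L0 w))//.
  by rewrite -[LHS]fineK ?e0//; have := integrable_fin_num measurableT iL.
have /(ae_eq_integral_abs P measurableT (measurable_int _ iL)) ae0 := int0.
have : P setT = 0%E.
  apply: measure_negligible => //; apply: negligibleS ae0 => w _ /= /(_ I) [].
  by move=> e; have := L0 w; rewrite e ltxx.
by move=> h; have := @probability_setT _ _ _ P; rewrite h => -[] /esym/eqP; rewrite oner_eq0.
Qed.

Section RandomSum.
Context d (T : measurableType d) (R : realType) (P : probability T R).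
Variables (X : nat -> {RV P >-> R}) (N : T -> nat).
Hypothesis indX : mutually_independent X.
Hypothesis idX : identically_distributed X.
Hypothesis mN : forall k, measurable (N @^-1` [set k]).
Hypothesis indN : independent_of_seq N X.

Lemma random_sum_law (A : set R) : measurable A ->
  P [set w | A (Ssum X (N w) w)] =
  (\sum_(k <oo) P (N @^-1` [set k]) * conv_pow (distribution P (X 0%N)) k A)%E.
Proof.
move=> mA.
have mS k : measurable (Ssum X k @^-1` A).
  by rewrite -[_ @^-1` _]setTI; exact: measurable_Ssum.
have -> : [set w | A (Ssum X (N w) w)] =
    \bigcup_k (N @^-1` [set k] `&` Ssum X k @^-1` A).
  apply/seteqP; split => w /=; first by move=> h; exists (N w).
  by move=> [k _ [/= <-]].
rewrite measure_semi_bigcup.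
- apply: eq_eseriesr => k _; apply: Ssum_conv_pow => // n B mB.
  by rewrite indN// indX.
- by move=> k; exact: measurableI.
- by move=> i j _ _ [w /= [[<- _] [<- _]]].
- by apply: bigcupT_measurable => k; exact: measurableI.
Qed.

End RandomSum.

Section MixedPoissonSum.
Context {R : realType}.
Context d (T : measurableType d) (P : probability T R) (L : {RV P >-> R}).
Hypothesis L0 : forall w, 0 < L w.
Variables (mu : probability R R) (sigma : R).
Hypothesis sigma0 : 0 < sigma.
Hypothesis imu2 : mu.-integrable setT (EFin \o (fun x => x ^+ 2)).
Hypothesis mean0 : \int[mu]_x x = 0.
Hypothesis var : \int[mu]_x (x ^+ 2) = sigma ^+ 2.

(** The compound Poisson bound holds for each value of [L]; the absolute value is moved inside and
    the bound integrated. *)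
Lemma mixed_poisson_sum_normal_approx (u : R) :
  (`| \int[P]_w compound_poisson mu (L0 w) `]-oo, u[
      - \int[P]_w (Phi (u / (sigma * Num.sqrt (L w))))%:E |
   <= (37 / 20 / sigma ^+ 2)%:E *
      \int[P]_w \int[mu]_x (truncated_moment sigma (L w, x))%:E)%E.
Proof.
have mL : measurable_fun setT L by exact: measurable_funP.
pose q w := fine (compound_poisson mu (L0 w) `]-oo, u[).
pose g w := Phi (u / (sigma * Num.sqrt (L w))).
have qE w : (q w)%:E = compound_poisson mu (L0 w) `]-oo, u[.
  by rewrite fineK// fin_num_measure.
(* The measure takes the proof [L0 w] as an argument, so measurability in [w] is read off the
   defining series, whose weights depend measurably on [L w]. *)
have mQ : measurable_fun setT (fun w => compound_poisson mu (L0 w) `]-oo, u[).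
  rewrite (_ : (fun w => _) = fun w => (\sum_(k <oo | k \in xpredT)
      (poisson_weight (L w) k)%:E * conv_pow mu k `]-oo, u[%classic)%E).
    apply: ge0_emeasurable_sum => [k w _ _|k _].
      by rewrite mule_ge0// lee_fin poisson_weight_ge0.
    apply: emeasurable_funM => //; apply/measurable_EFinP.
    apply: measurable_funM => //; apply: measurable_funM; last exact: measurable_funX.
    by apply: measurableT_comp => //; exact: measurableT_comp.
  by apply/funext => w; rewrite compound_poissonE.
have mq : measurable_fun setT q by exact: measurableT_comp.
have mg : measurable_fun setT g.
  apply: measurableT_comp; first exact: measurable_Phi.
  apply: measurable_funM => //; apply: measurable_inv_ge0 => [|w].
    by apply: measurable_funM => //; exact: measurable_sqrtr.
  by rewrite mulr_ge0 ?sqrtr_ge0// ltW.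
have iq : P.-integrable setT (EFin \o q).
  apply: (@integrable_bounded _ _ _ P q 1) => // w.
  by rewrite ger0_norm ?fine_ge0// -lee_fin qE; exact: probability_le1.
have ig : P.-integrable setT (EFin \o g).
  apply: (@integrable_bounded _ _ _ P g 1) => // w.
  by rewrite ger0_norm ?Phi_ge0 ?Phi_le1.
have -> : (\int[P]_w compound_poisson mu (L0 w) `]-oo, u[ = \int[P]_w (q w)%:E)%E.
  by apply: eq_integral => w _; rewrite qE.
rewrite -integralB_EFin//.
apply: (le_trans (le_abse_integral P measurableT _)).
  by apply/measurable_EFinP; exact: measurable_funB.
have mI : measurable_fun setT
    (fun w => \int[mu]_x (truncated_moment sigma (L w, x))%:E)%E.
  apply: (measurableT_comp (measurable_mixed mu (measurable_truncated_moment sigma0)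
    (truncated_moment_ge0 sigma0)) mL).
have I0 w : (0 <= \int[mu]_x (truncated_moment sigma (L w, x))%:E)%E.
  by apply: integral_ge0 => x _; rewrite lee_fin truncated_moment_ge0.
have k0 : 0 <= 37 / 20 / sigma ^+ 2 by rewrite divr_ge0 ?sqr_ge0.
rewrite -ge0_integralZl//; apply: ge0_le_integral => //.
- by apply: measurableT_comp => //; apply/measurable_EFinP; exact: measurable_funB.
- by apply: emeasurable_funM.
- move=> w _.
  have iw : mu.-integrable setT (EFin \o (fun x => truncated_moment sigma (L w, x))).
    apply: (@integrable_dominated _ _ _ mu _ (fun x => x ^+ 2)) => //.
      apply: measurableT_comp => //; exact: measurable_truncated_moment.
    move=> x; rewrite ger0_norm ?truncated_moment_ge0// ler_piMr ?sqr_ge0//.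
    by rewrite ge_min lexx.
  have := compound_poisson_normal_approx (L0 w) sigma0 imu2 mean0 var u.
  rewrite -lee_fin EFinM fineK//.
  by have := integrable_fin_num measurableT iw.
Qed.

End MixedPoissonSum.

Unset Implicit Arguments.
Set Strict Implicit.

Theorem theorem9
  (R : realType)
  (d : measure_display) (T : measurableType d) (P : probability T R)
  (X : nat -> {RV P >-> R}) (sigma : R)
  (d' : measure_display) (T' : measurableType d') (P' : probability T' R)
  (L : {RV P' >-> R}) (N : T -> nat) :
  mutually_independent X ->
  identically_distributed X ->
  ('E_P[X 0%N] = 0)%E ->
  0 < sigma ->
  (\int[P]_w ((X 0%N w) ^+ 2)%:E = (sigma ^+ 2)%:E)%E ->
  (forall w, 0 < L w) ->
  P'.-integrable setT (EFin \o L) ->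
  (forall k, measurable (N @^-1` [set k])) ->
  independent_of_seq N X ->
  (forall k : nat, P (N @^-1` [set k]) =
     (\int[P']_w (expR (- L w) * (L w) ^+ k / (k`!)%:R)%:E)%E) ->
  let EL := fine ('E_P'[L])%E in
  let RHS :=
    (\int[distribution P' L]_lam \int[distribution P (X 0%N)]_x
        (x ^+ 2 * Num.min 1 (`|x| / (sigma * Num.sqrt lam)))%:E)%E in
  (forall x : R,
    (`| P [set w | (Ssum X (N w) w < x * sigma * Num.sqrt EL)%R]
        - \int[P']_w (Phi (x / Num.sqrt (L w / EL)))%:E |
     <= (18546 / 10000 / sigma ^+ 2)%:E * RHS)%E)
  /\
  RHS =
    (\int[distribution P' L]_lam \int[distribution P (X 0%N)]_x
        (x ^+ 2 * ((sigma * Num.sqrt lam <= `|x|)%R : bool)%:R)%:E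
     + \int[distribution P' L]_lam \int[distribution P (X 0%N)]_x
        ((`|x| ^+ 3 / (sigma * Num.sqrt lam)) * ((`|x| < sigma * Num.sqrt lam)%R : bool)%:R)%:E)%E.
Proof.
move=> indX idX EX sigma0 varX L0 iL mN indN pN EL RHS.
pose mu : probability R R := distribution P (X 0%N).
have mX : measurable_fun setT (X 0%N) by exact: measurable_funP.
have iX2 : P.-integrable setT (EFin \o (fun w => X 0%N w ^+ 2)).
  apply/integrableP; split; first exact/measurable_EFinP/measurable_funX.
  under eq_integral => w _ do rewrite gee0_abs ?lee_fin ?sqr_ge0//.
  by rewrite varX ltry.
have imu2 : mu.-integrable setT (EFin \o (fun x => x ^+ 2)).
  by apply: integrable_pushforward => //; exact/measurable_EFinP/measurable_funX.
have mean0 : \int[mu]_x x = 0.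
  rewrite /Rintegral integral_distribution//.
  - by move: EX; rewrite unlock => ->.
  - exact: integrable_sqr.
have var : \int[mu]_x (x ^+ 2) = sigma ^+ 2.
  rewrite /Rintegral integral_distribution//; first by rewrite [X in fine X]varX.
  exact/measurable_EFinP/measurable_funX.
have RHSE : RHS = (\int[P']_w \int[mu]_x (truncated_moment sigma (L w, x))%:E)%E.
  exact: (integral_mixed L mu (measurable_truncated_moment sigma0)
    (truncated_moment_ge0 sigma0)).
split; last first.
  transitivity (\int[distribution P' L]_lam \int[mu]_x (tail_moment sigma (lam, x))%:E +
    \int[distribution P' L]_lam \int[mu]_x (body_moment sigma (lam, x))%:E)%E; last by [].
  have mt := @measurable_tail_moment R sigma; have mb := measurable_body_moment sigma0.
  have t0 := @tail_moment_ge0 R sigma; have b0 := body_moment_ge0 sigma0.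
  have mL : measurable_fun setT L by exact: measurable_funP.
  rewrite RHSE !integral_mixed// -ge0_integralD//.
  - apply: eq_integral => w _; rewrite -ge0_integralD//.
    + by apply: eq_integral => x _; rewrite truncated_momentE.
    + by move=> x _; rewrite lee_fin.
    + by apply/measurable_EFinP; exact: measurableT_comp.
    + by move=> x _; rewrite lee_fin.
    + by apply/measurable_EFinP; exact: measurableT_comp.
  - by move=> w _; apply: integral_ge0 => x _; rewrite lee_fin.
  - exact: (measurableT_comp (measurable_mixed mu mt t0) mL).
  - by move=> w _; apply: integral_ge0 => x _; rewrite lee_fin.
  - exact: (measurableT_comp (measurable_mixed mu mb b0) mL).
move=> x; set u := x * sigma * Num.sqrt EL.
have EL0 : 0 < EL by rewrite /EL unlock; exact: expectation_gt0.
(* The law of [N] enters through [pN]; exchanging the sum over [k] with the integral over [L], all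
   terms being nonnegative, produces the mixture of compound Poisson laws. *)
have -> : P [set w | Ssum X (N w) w < u] =
    (\int[P']_w compound_poisson mu (L0 w) `]-oo, u[)%E.
  transitivity (P [set w | `]-oo, u[%classic (Ssum X (N w) w)]).
    by congr (P _); apply/funext => w /=; rewrite in_itv.
  rewrite random_sum_law//.
  transitivity (\int[P']_w (\sum_(k <oo)
    (poisson_weight (L w) k)%:E * conv_pow mu k `]-oo, u[%classic))%E; last by [].
  have mw k : measurable_fun setT (fun w => (poisson_weight (L w) k)%:E).
    apply/measurable_EFinP/measurable_funM => //; apply: measurable_funM.
      by apply: measurableT_comp => //; exact: measurableT_comp.
    exact: measurable_funX.
  have w0 k w : (0 <= (poisson_weight (L w) k)%:E)%E.
    by rewrite lee_fin poisson_weight_ge0.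
  rewrite integral_nneseries//.
  - apply: eq_eseriesr => k _; rewrite pN.
    by rewrite ge0_integralZr//; exact: mw.
  - by move=> k; apply: emeasurable_funM => //; exact: mw.
  - by move=> k w _; rewrite mule_ge0.
have -> : (\int[P']_w (Phi (x / Num.sqrt (L w / EL)))%:E =
    \int[P']_w (Phi (u / (sigma * Num.sqrt (L w))))%:E)%E.
  (* The factors [sigma] and [Num.sqrt EL] in [u] cancel: normalizing by the mean intensity is the
     same as rescaling the argument by the actual one. *)
  apply: eq_integral => w _; congr (Phi _)%:E; rewrite /u sqrtrM ?(ltW (L0 w))//.
  rewrite sqrtrV ?(ltW EL0)//.
  have : 0 < Num.sqrt EL by rewrite sqrtr_gt0.
  have : 0 < Num.sqrt (L w) by rewrite sqrtr_gt0.
  by move: (Num.sqrt _) (Num.sqrt _) => a b a0 b0; field; rewrite !gt_eqF.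
apply: (le_trans (mixed_poisson_sum_normal_approx L0 sigma0 imu2 mean0 var u)).
rewrite -RHSE; apply: lee_wpmul2r.
  rewrite RHSE; apply: integral_ge0 => w _; apply: integral_ge0 => y _.
  by rewrite lee_fin truncated_moment_ge0.
(* What remains is [37 / 20 = 1.85 <= 1.8546]. *)
rewrite lee_fin ler_wpM2r ?invr_ge0 ?sqr_ge0//.
rewrite ler_pdivrMr ?ltr0n// mulrAC ler_pdivlMr ?ltr0n// -!natrM ler_nat.
by vm_compute.
Qed.
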